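(* Let $\mathcal{P}$ be the Cauchy transform on the unit disk defined below. For $p>2$, with $q=p/(p-1)$ the conjugate exponent of $p$, $$\|\mathcal{P}\|_{L^p\to L^{\infty}}=2\left(\frac{\Gamma(2-q)}{\Gamma^2(2-\frac{q}{2})}\right)^{1/q},$$ where $\Gamma$ is the Gamma function. In particular, for $p=\infty$, $\|\mathcal{P}\|_{L^\infty\to L^\infty}=\frac{8}{\pi}$.
   Context: $\mathbb{D}=\{z\in\mathbb{C}:|z|<1\}$ and $\mathrm{d}A(z)=\frac{1}{\pi}\,\mathrm{d}x\,\mathrm{d}y$ is the normalized area measure; $L^p=L^p(\mathbb{D},\mathrm{d}A)$ with $\|\varphi\|_p=(\int_{\mathbb{D}}|\varphi|^p\mathrm{d}A)^{1/p}$ and $\|\varphi\|_\infty$ the essential supremum. For $\varphi\in L^p(\mathbb{D},\mathrm{d}A)$ and $z\in\mathbb{D}$, $$\mathcal{P}[\varphi](z)=-\int_{\mathbb{D}}\left(\frac{\varphi(w)}{w-z}+\frac{z\overline{\varphi(w)}}{1-\bar{w}z}\right)\mathrm{d}A(w).$$ The operator norm is $\|\mathcal{P}\|_{L^p\to L^\infty}=\sup\{\|\mathcal{P}[\varphi]\|_\infty:\|\varphi\|_p=1\}$. *)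

(* Defs.v *)
From HB Require Import structures.
From mathcomp Require Import all_boot all_algebra.
From mathcomp Require Import all_classical all_reals all_analysis.
From mathcomp Require Import complex.
Set Implicit Arguments. Unset Strict Implicit. Unset Printing Implicit Defensive.
Import GRing.Theory Num.Theory.
Import numFieldNormedType.Exports.
Local Open Scope classical_set_scope.
Local Open Scope ring_scope.

Lemma invr_ge0_pi (R : realType) : 0 <= (pi : R)^-1.
Proof. by rewrite invr_ge0 pi_ge0. Qed.

Section Defs.
Variable R : realType.

Definition Gamma (s : R) : R :=
  Rintegral (@lebesgue_measure R) `]0, +oo[%classic
    (fun t => powR t (s - 1) * expR (- t)).

Definition leb2 := ((@lebesgue_measure R) \x (@lebesgue_measure R))%E.
Definition Pt := (R * R)%type.

(* normalized area measure dA = (1/pi) dx dy *)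
Definition dA := mscale (NngNum (invr_ge0_pi R)) leb2.

Definition toC (w : Pt) : R[i] := (w.1 +i* w.2)%C.
Definition cmod (z : R[i]) : R := Num.sqrt (complex.Re z ^+ 2 + complex.Im z ^+ 2).

Definition Disk : set Pt := [set w | w.1 ^+ 2 + w.2 ^+ 2 < 1].

Definition cint (f : Pt -> R[i]) : R[i] :=
  ((Rintegral dA Disk (fun w => complex.Re (f w)))
    +i* (Rintegral dA Disk (fun w => complex.Im (f w))))%C.

Definition Pcauchy (phi : Pt -> R[i]) (z : Pt) : R[i] :=
  - cint (fun w => phi w / (toC w - toC z)
                   + toC z * conjc (phi w) / (1 - conjc (toC w) * toC z)).

Definition normD (p : \bar R) (f : Pt -> R[i]) : \bar R :=
  Lnorm dA p (fun w => (\1_Disk w * cmod (f w))%:E).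

Definition unit_Lp (p : \bar R) (phi : Pt -> R[i]) : Prop :=
  measurable_fun setT (fun w => complex.Re (phi w)) /\
  measurable_fun setT (fun w => complex.Im (phi w)) /\
  normD p phi = 1%E.

Definition opnorm (p : \bar R) : \bar R :=
  ereal_sup [set normD +oo%E (Pcauchy phi) | phi in unit_Lp p].

End Defs.

(* Main.v *)
Require Import Defs.
From HB Require Import structures.
From mathcomp Require Import all_boot all_order all_algebra.
From mathcomp Require Import all_classical all_reals all_analysis.
From mathcomp Require Import measurable_realfun ess_sup_inf complex.
From mathcomp Require Import ring lra.
Set Implicit Arguments. Unset Strict Implicit. Unset Printing Implicit Defensive.
Import Order.TTheory GRing.Theory Num.Theory.
Import numFieldNormedType.Exports.
Local Open Scope classical_set_scope.
Local Open Scope ring_scope.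

(** By duality the value at [z] of the transform is controlled by the [L^q] norm
    of the kernel [|w - z|^-1 + |z| |1 - conj w z|^-1], and convexity of [t^q]
    bounds the [q]-th power of that norm by [2^(q-1) (U(z) + U(z'))], where
    [U(z)] is the integral of [|w - z|^-q] over the disk and [z' = 1 / conj z].
    On each horizontal slice of the disk the potential [u(r)] of a real point [r]
    satisfies [u'(1/r) = r^q u'(r)] with [u' <= 0], so [u(r) + u(1/r)] increases
    to [2 u(1)] on [(0, 1)]; hence [U(z) + U(z') <= 2 U(1)].  The bound is
    attained in the limit [z -> 1] by truncations of
    [i (w - 1) |w - 1|^-q].  Finally [U(1)] is computed by integrating along the
    lines through the point [1], which leaves the integral of [(1 + t^2)^-s],
    and two evaluations of the latter by Gamma integrals. *)

(** Here [h] stands for [q / 2], all potentials being written with squared distances. The bounds on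
    the kernel combine to 2^(q-1) * 2 U(1) = 2^q U(1), whose [q]-th root gives the factor 2 of the
    formula; nothing is lost at z = 1, where both terms of the kernel have the same modulus. At z =
    1 the integrand is v - conj v = 2i Im v with v = phi / (w - 1). An extremal must therefore make
    v a positive multiple of i, while equality in Hoelder's inequality forces |phi| to be
    proportional to |w - 1|^(1-q); this determines the extremal up to a positive factor. As 1 is not
    in the disk, the kernel is compared with its value at 1 from inside, and cutting a neighbourhood
    of 1 out of the support makes the comparison uniform. Points z of the real axis are set aside:
    the reduction to a real r > 0 uses a factorization of rotations that degenerates when the sine
    vanishes, and an essential supremum ignores null sets. The integral of (1 + t^2)^-s is
    eliminated between its two evaluations, which together contain Legendre's duplication
    formula. *)

(** * Affine changes of variable on the line, shears and rotations of the plane *)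

Section AffineAndRotation.
Context {R : realType}.
Notation mu := (@lebesgue_measure R).
Implicit Types (a b c k s : R) (f : R -> \bar R) (G : R * R -> \bar R) (x y : R).

Lemma measurable_affine a b :
  measurable_fun setT (fun x : R => (a * x + b)%R : measurableTypeR R).
Proof. by apply: measurable_funD => //; exact: mulrl_measurable. Qed.

Lemma preimage_affine_itv a b x y : (0 < a)%R ->
  (fun t : R => (a * t + b)%R) @^-1` `]x, y] = `](x - b) / a, (y - b) / a]%classic.
Proof.
move=> a0; apply/seteqP; split=> t /=; rewrite !in_itv /=.
  by rewrite ltr_pdivrMr// ler_pdivlMr// ltrBlDr lerBrDr (mulrC t).
by rewrite ltr_pdivrMr// ler_pdivlMr// ltrBlDr lerBrDr (mulrC t).
Qed.

Local Open Scope ereal_scope.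

(** Lebesgue measure equals [a] times its image under the affine map because the two agree on
    half-open intervals, which determine it. Hence the change of variables for every nonnegative
    measurable [f], without smoothness. *)
Lemma ge0_integral_affine a b f : (0 < a)%R ->
  measurable_fun setT f -> (forall x, 0 <= f x) ->
  \int[mu]_x f x = a%:E * \int[mu]_x f (a * x + b)%R.
Proof.
move=> a0 mf f0; pose h x : measurableTypeR R := (a * x + b)%R.
have mh : measurable_fun setT h by exact: measurable_affine.
pose nu := mscale (NngNum (ltW a0)) (pushforward mu h).
have -> : \int[mu]_x f x = \int[nu mh]_x f x.
  apply: eq_measure_integral => /= A mA _.
  apply: lebesgue_measure_unique => // _ [[x y] _ <-].
  change (mu `]x, y] = a%:E * mu ((fun t : R => (a * t + b)%R) @^-1` `]x, y])).
  rewrite preimage_affine_itv//.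
  rewrite !lebesgue_measure_itv/=.
  rewrite !lte_fin ltr_pM2r ?invr_gt0// ltrD2r; case: ifPn => _; last by rewrite mule0.
  by rewrite -EFinM; congr EFin; field; rewrite gt_eqF.
rewrite ge0_integral_mscale//; congr (_ * _).
by rewrite ge0_integral_pushforward.
Qed.

Lemma ge0_integral_shift b f : measurable_fun setT f -> (forall x, 0 <= f x) ->
  \int[mu]_x f (x + b)%R = \int[mu]_x f x.
Proof.
move=> mf f0; rewrite [RHS](@ge0_integral_affine 1%R b)// mul1e.
by apply: eq_integral => x _; rewrite mul1r.
Qed.

Notation leb := (@leb2 R).

Lemma ge0_integral_shear1 k G : measurable_fun setT G -> (forall w, 0 <= G w) ->
  \int[leb]_w G (w.1 + k * w.2, w.2)%R = \int[leb]_w G w.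
Proof.
move=> mG G0; rewrite /leb2 fubini_tonelli2//=.
  rewrite fubini_tonelli2//; apply: eq_integral => y _; rewrite /fubini_G.
  rewrite (ge0_integral_shift (k * y)%R (f := fun x => G (x, y)))//.
  exact: measurableT_comp.
apply: measurableT_comp => //; apply: measurable_fun_pair => //.
apply: measurable_funD => //; exact: measurable_funM.
Qed.

Lemma ge0_integral_shear2 k G : measurable_fun setT G -> (forall w, 0 <= G w) ->
  \int[leb]_w G (w.1, w.2 + k * w.1)%R = \int[leb]_w G w.
Proof.
move=> mG G0; rewrite /leb2 fubini_tonelli1//=.
  rewrite fubini_tonelli1//; apply: eq_integral => x _; rewrite /fubini_F.
  rewrite (ge0_integral_shift (k * x)%R (f := fun y => G (x, y)))//.
  exact: measurableT_comp.
apply: measurableT_comp => //; apply: measurable_fun_pair => //.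
apply: measurable_funD => //; exact: measurable_funM.
Qed.

(* A rotation other than a half turn is a product of three shears. *)
Lemma ge0_integral_rotation c s G : (c ^+ 2 + s ^+ 2 = 1)%R -> s != 0%R ->
  measurable_fun setT G -> (forall w, 0 <= G w) ->
  \int[leb]_w G (c * w.1 - s * w.2, s * w.1 + c * w.2)%R = \int[leb]_w G w.
Proof.
(* For [c] and [s] the cosine and sine of an angle, [k] is minus the tangent of half the angle. *)
move=> cs1 s0 mG G0; pose k := ((c - 1) / s)%R.
have mS1 : measurable_fun setT (fun w : R * R => (w.1 + k * w.2, w.2)%R).
  apply: measurable_fun_pair => //.
  by apply: measurable_funD => //; exact: measurable_funM.
have mS2 : measurable_fun setT (fun w : R * R => (w.1, w.2 + s * w.1)%R).
  apply: measurable_fun_pair => //.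
  by apply: measurable_funD => //; exact: measurable_funM.
rewrite -[RHS](ge0_integral_shear1 k)//.
rewrite -[RHS](ge0_integral_shear2 s) /=; last 2 first.
- exact: measurableT_comp mG mS1.
- by move=> w.
rewrite -[RHS](ge0_integral_shear1 k) /=; last 2 first.
- exact: measurableT_comp (measurableT_comp mG mS1) mS2.
- by move=> w.
apply: eq_integral => -[x y] _ /=; congr (G (_, _)); rewrite /k; last by field.
have -> : (s * y = (1 - c ^+ 2) / s * y)%R by rewrite -cs1; field.
by field.
Qed.

End AffineAndRotation.

(** * Antiderivatives and the fundamental theorem of calculus *)

Section Calculus.
Context {R : realType}.
Notation mu := (@lebesgue_measure R).

Lemma is_derive1_continuous (F : R -> R) (x d : R) :
  is_derive x 1 F d -> {for x, continuous F}.
Proof.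
by move=> dF; apply/differentiable_continuous/derivable1_diffP; exact: ex_derive.
Qed.

Lemma integral_itv_is_derive (f F : R -> R) (x y : R) : x <= y ->
  (forall t, x <= t <= y -> is_derive t 1 F (f t)) ->
  {within `[x, y], continuous f} ->
  (\int[mu]_(t in `[x, y]) (f t)%:E = (F y - F x)%:E)%E.
Proof.
rewrite le_eqVlt => /predU1P[-> _ _|xy dF cf].
  by rewrite set_itv1 integral_set1 subrr.
rewrite EFinB (continuous_FTC2 (F := F) xy cf)//.
- split=> [t /[!in_itv]/= /andP[xt ty]||].
  + by apply: ex_derive; apply: dF; rewrite !ltW.
  + apply: cvg_at_right_filter; apply: is_derive1_continuous; apply: dF.
    by rewrite lexx ltW.
  + apply: cvg_at_left_filter; apply: is_derive1_continuous; apply: dF.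
    by rewrite lexx ltW.
- move=> t /[!in_itv]/= /andP[xt ty]; rewrite derive1E.
  by have /(_ _)/@derive_val -> // := dF t; rewrite !ltW.
Qed.

(** Derivatives are claimed only to the right of the base point, so [c] is to be chosen below every
    argument that will occur. *)
Lemma continuous_antiderivative (f : R -> R) (c : R) : continuous f ->
  exists F : R -> R, forall x, c < x -> is_derive x 1 F (f x).
Proof.
move=> cf; exists (fun x => (\int[mu]_(t in `[c, x]) f t)%R) => x cx.
have xx1 : x < x + 1 by rewrite ltrDl.
have intf : mu.-integrable `[c, x + 1] (EFin \o f).
  apply: continuous_compact_integrable; first exact: segment_compact.
  exact: continuous_subspaceT.
have [dF F'] := continuous_FTC1_closed xx1 intf cx (cf x).
by apply: (DeriveDef dF); rewrite -derive1E.
Qed.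

Lemma is_derive1_shift (F : R -> R) (k x d : R) :
  is_derive (x + k) 1 F d -> is_derive x 1 (fun t => F (t + k)) d.
Proof.
move=> dF; rewrite -[d]mulr1; apply: (is_derive1_comp (f := F)) => //.
by apply: is_derive_eq; rewrite addr0.
Qed.

End Calculus.

(** * The potential of a horizontal slice of the disk *)

Section Slice.
Context {R : realType}.
Notation mu := (@lebesgue_measure R).
Variables (h y a : R).
Hypotheses (h01 : 0 <= h < 1) (y0 : y != 0) (a0 : 0 <= a) (ay : a ^+ 2 + y ^+ 2 = 1).

Let f (t : R) := (t ^+ 2 + y ^+ 2) `^ (- h).

Let base_gt0 t : 0 < t ^+ 2 + y ^+ 2.
Proof. by rewrite ltr_wpDl ?sqr_ge0// exprn_even_gt0. Qed.

Let cf : continuous f.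
Proof.
move=> t; apply: (is_derive1_continuous (d := (- h * (t ^+ 2 + y ^+ 2) `^ (- h - 1)) * (2 * t))).
apply: (is_derive1_comp (f := fun u => u `^ (- h))).
  exact: is_derive1_powR.
by apply: is_derive_eq; rewrite addr0 /GRing.scale /= mulr1 -mulr2n mulr_natl.
Qed.

(** The distances from a point of the unit circle to the inverse points [- r] and [- r^-1] are in
    the constant ratio [r]. *)
Let f_inv (r b : R) : 0 < r -> b ^+ 2 + y ^+ 2 = 1 -> f (r^-1 + b) = r `^ (2 * h) * f (r + b).
Proof.
move=> r0 by1; rewrite /f.
have -> : (r^-1 + b) ^+ 2 + y ^+ 2 = r `^ (- 2) * ((r + b) ^+ 2 + y ^+ 2).
  rewrite powR_invn ?(ltW r0)//.
  have -> : y ^+ 2 = 1 - b ^+ 2 by rewrite -by1 addrAC subrr add0r.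
  by field; rewrite gt_eqF.
rewrite powRM ?powR_ge0// ?ltW//; congr (_ * _).
by rewrite -powRrM mulrNN.
Qed.

(** The derivative of the slice potential involves only the two end points of the slice. These lie
    on the unit circle, so [f_inv] relates the derivatives at [s] and [s^-1]. *)
Lemma slice_potential_le (r : R) : 0 < r < 1 ->
  (\int[mu]_(x in `[(- a)%R, a]) (((x - r) ^+ 2 + y ^+ 2) `^ (- h))%:E +
   \int[mu]_(x in `[(- a)%R, a]) (((x - r^-1) ^+ 2 + y ^+ 2) `^ (- h))%:E <=
   2%:E * \int[mu]_(x in `[(- a)%R, a]) (((x - 1) ^+ 2 + y ^+ 2) `^ (- h))%:E)%E.
Proof.
(* All arguments given to the antiderivative have the form [b - s] with [b >= - a] and [s <= r^-1],
   hence exceed [c]. *)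
move=> /andP[r0 r1]; pose c : R := - a - r^-1 - 1.
have [F dF] := continuous_antiderivative c cf.
have uE s : s <= r^-1 ->
    (\int[mu]_(x in `[(- a)%R, a]) (((x - s) ^+ 2 + y ^+ 2) `^ (- h))%:E =
     (F (a - s) - F (- a - s))%:E)%E.
  move=> sr; apply: (integral_itv_is_derive (F := fun x => F (x - s))).
  - by rewrite (le_trans _ a0)// oppr_le0.
  - move=> t /andP[at1 _]; apply: is_derive1_shift; apply: dF.
    by rewrite /c; lra.
  - apply: continuous_subspaceT => x.
    apply: (@continuous_comp _ _ _ (fun x : R => x - s) f); last exact: cf.
    by apply: cvgB; [exact: cvg_id|exact: cvg_cst].
have r1V : 1 <= r^-1 by rewrite invf_ge1// ltW.
rewrite !uE//; last exact: le_trans (ltW r1) r1V.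
rewrite -EFinD -EFinM lee_fin.
pose g s := F (a - s) - F (- a - s) + (F (a - s^-1) - F (- a - s^-1)).
have dg s : s \in `[r, 1] ->
   is_derive s 1 g ((f (s + a) - f (s - a)) * (1 - s `^ (2 * h - 2))).
  rewrite in_itv/= => /andP[rs s1]; have s0 : 0 < s by exact: lt_le_trans rs.
  have sr : s^-1 <= r^-1 by rewrite lef_pV2.
  have dFs b : - a <= b -> is_derive s 1 (fun t => F (b - t)) (- f (s - b)).
    move=> ab; have -> : f (s - b) = f (b - s) by rewrite /f; congr (_ `^ _); ring.
    rewrite -mulrN1; apply: (is_derive1_comp (f := F)).
      by apply: dF; rewrite /c; lra.
    by apply: is_derive_eq; rewrite add0r mul1r.
  have dFi b : - a <= b -> b ^+ 2 + y ^+ 2 = 1 ->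
      is_derive s 1 (fun t => F (b - t^-1)) (s `^ (2 * h - 2) * f (s - b)).
    move=> ab by1.
    have -> : s `^ (2 * h - 2) * f (s - b) = f (b - s^-1) * s ^- 2.
      have -> : f (b - s^-1) = f (s^-1 - b) by rewrite /f; congr (_ `^ _); ring.
      rewrite f_inv ?sqrrN// powRB; last by apply/implyP => _; rewrite gt_eqF.
      by rewrite -powR_mulrn ?(ltW s0)// mulrAC.
    apply: (is_derive1_comp (f := F)).
      by apply: dF; rewrite /c; lra.
    have sn0 : id s != 0 by rewrite gt_eqF.
    have dV := is_deriveV sn0 (is_derive_id s 1).
    by apply: is_derive_eq; rewrite add0r mul1r /GRing.scale /= mulr1 opprK.
  have Na : (- a) ^+ 2 + y ^+ 2 = 1 by rewrite sqrrN.
  have aa : - a <= a by rewrite (le_trans _ a0)// oppr_le0.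
  apply: (is_derive_eq (is_deriveD (is_deriveB (dFs a aa) (dFs (- a) (lexx _)))
    (is_deriveB (dFi a aa ay) (dFi (- a) (lexx _) Na)))).
  by rewrite !opprK; ring.
suff : g r <= g 1 by rewrite /g invr1; lra.
have drg s : s \in `]r, 1[ -> derivable g s 1.
  by move=> srs; have := dg _ (subset_itv_oo_cc srs) => ?; exact: ex_derive.
apply: (ger0_derive1_le_cc drg); rewrite ?in_itv/= ?lexx ?ltW//.
- move=> s srs; have {}dgs := dg _ (subset_itv_oo_cc srs).
  rewrite derive1E derive_val.
  move: srs; rewrite in_itv/= => /andP[rs s1]; have s0 : 0 < s by exact: lt_trans rs.
  (* Both factors are nonpositive: [s + a] is at least as far from 0 as [s - a], and [s < 1] is
     raised to the negative exponent [2 * h - 2]. *)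
  apply: mulr_le0; rewrite subr_le0.
    rewrite /f !powRN lef_pV2 ?posrE ?powR_gt0//; apply: ge0_ler_powR.
    - by case/andP: h01.
    - by rewrite nnegrE ltW.
    - by rewrite nnegrE ltW.
    - rewrite lerD2r -subr_ge0.
      have -> : (s + a) ^+ 2 - (s - a) ^+ 2 = 4 * (s * a) by ring.
      by rewrite mulr_ge0// mulr_ge0// ltW.
  rewrite -[leLHS](powRr0 s); apply: ger_powR; first by rewrite s0 ltW.
  by case/andP: h01 => _; lra.
- by apply: derivable_within_continuous => s /dg ?; exact: ex_derive.
Qed.

End Slice.

(** * Densities on the plane and slices of the disk *)

Section PlanarDensities.
Context {R : realType}.
Notation mu := (@lebesgue_measure R).
Implicit Types (z w : R * R) (h : R).

Definition sqdist z w : R := (w.1 - z.1) ^+ 2 + (w.2 - z.2) ^+ 2.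

(* Squared modulus of [1 - conj w * z]. *)
Definition sqrefl z w : R :=
  1 - 2 * (w.1 * z.1 + w.2 * z.2) + (w.1 ^+ 2 + w.2 ^+ 2) * (z.1 ^+ 2 + z.2 ^+ 2).

Lemma sqdist_ge0 z w : 0 <= sqdist z w.
Proof. by rewrite addr_ge0 ?sqr_ge0. Qed.

Lemma sqreflE z w : sqrefl z w =
  (1 - (w.1 * z.1 + w.2 * z.2)) ^+ 2 + (w.1 * z.2 - w.2 * z.1) ^+ 2.
Proof. by rewrite /sqrefl; ring. Qed.

Lemma sqrefl_ge0 z w : 0 <= sqrefl z w.
Proof. by rewrite sqreflE addr_ge0 ?sqr_ge0. Qed.

Lemma measurable_sqdist z : measurable_fun setT (sqdist z).
Proof.
by apply: measurable_funD; apply: measurable_funX; apply: measurable_funB.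
Qed.

Lemma measurable_sqrefl z : measurable_fun setT (sqrefl z).
Proof.
apply: measurable_funD.
  apply: measurable_funB => //; apply: measurable_funM => //.
  by apply: measurable_funD; apply: measurable_funM.
apply: measurable_funM => //.
by apply: measurable_funD; apply: measurable_funX.
Qed.

Lemma measurable_powR_comp (f : R * R -> R) h : measurable_fun setT f ->
  measurable_fun setT (fun w => f w `^ h).
Proof. exact: (measurableT_comp (measurable_powR h)). Qed.

Lemma measurable_Disk : measurable (@Disk R).
Proof.
have m2 : measurable_fun setT (fun w : R * R => w.1 ^+ 2 + w.2 ^+ 2).
  by apply: measurable_funD; apply: measurable_funX.
rewrite (_ : @Disk R = setT `&` (fun w : R * R => w.1 ^+ 2 + w.2 ^+ 2) @^-1` `]-oo, 1[).
  by apply: m2.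
by apply/seteqP; split=> w; rewrite /Disk /= in_itv/= => -[].
Qed.

(* [|w - z|^(-2h) + |w - 1/conj z|^(-2h)], written so as to make sense at [z = 0]. *)
Definition dipole h z w : R :=
  sqdist z w `^ (- h) + (z.1 ^+ 2 + z.2 ^+ 2) `^ h * sqrefl z w `^ (- h).

Lemma dipole_ge0 h z w : 0 <= dipole h z w.
Proof. by rewrite addr_ge0 ?mulr_ge0 ?powR_ge0. Qed.

Lemma measurable_dipole h z : measurable_fun setT (dipole h z).
Proof.
apply: measurable_funD.
  apply: measurable_powR_comp; exact: measurable_sqdist.
apply: measurable_funM; first exact: measurable_cst.
apply: measurable_powR_comp; exact: measurable_sqrefl.
Qed.

Lemma Disk_slice (y x : R) : y ^+ 2 < 1 ->
  @Disk R (x, y) <-> x \in `](- Num.sqrt (1 - y ^+ 2)), Num.sqrt (1 - y ^+ 2)[.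
Proof.
move=> y1; have b0 : 0 < 1 - y ^+ 2 by rewrite subr_gt0.
rewrite /Disk /= -ltrBrDr in_itv/= -ltr_norml -[in X in X <-> _](sqr_sqrtr (ltW b0)).
by rewrite -[x ^+ 2]real_normK ?num_real// ltr_pXn2r ?nnegrE ?sqrtr_ge0.
Qed.

Lemma integral_Disk_slice (y : R) (f : R * R -> R) : y ^+ 2 < 1 ->
  measurable_fun setT f ->
  (\int[mu]_x ((EFin \o f) \_ (@Disk R)) (x, y) =
   \int[mu]_(x in `[(- Num.sqrt (1 - y ^+ 2))%R, Num.sqrt (1 - y ^+ 2)]) (f (x, y))%:E)%E.
Proof.
move=> y1 mf.
have mfy : measurable_fun setT (fun x => (f (x, y))%:E).
  apply/measurable_EFinP; exact: measurableT_comp.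
rewrite [RHS](@integral_itv_bndoo _ _ _ _ true false)//; last exact: measurable_funTS.
rewrite [RHS]integral_mkcond; apply: eq_integral => x _.
rewrite /patch; congr (if _ then _ else _).
by apply/idP/idP; rewrite !inE => /Disk_slice; apply.
Qed.

End PlanarDensities.

(** * Comparing the dipole potential with the potential at 1 *)

Section DipolePotential.
Context {R : realType}.
Notation mu := (@lebesgue_measure R).
Notation leb := (@leb2 R).
Notation D := (@Disk R).
Implicit Types (z w : R * R) (h : R).

(** The weight of the second term of [dipole] cancels the factor [r ^+ 2] between [sqrefl] and the
    squared distance to the reflected point [r^-1]. *)
Lemma dipole_axis h (r : R) w : 0 < r ->
  dipole h (r, 0) w = ((w.1 - r) ^+ 2 + w.2 ^+ 2) `^ (- h)
                    + ((w.1 - r^-1) ^+ 2 + w.2 ^+ 2) `^ (- h).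
Proof.
move=> r0; rewrite /dipole /sqdist /= subr0; congr (_ + _).
have -> : sqrefl (r, 0) w = r ^+ 2 * ((w.1 - r^-1) ^+ 2 + w.2 ^+ 2).
  by rewrite /sqrefl /=; field; rewrite gt_eqF.
rewrite expr0n /= addr0 powRM ?sqr_ge0 ?addr_ge0 ?sqr_ge0// mulrA powRN mulfV ?mul1r//.
by rewrite gt_eqF// powR_gt0// exprn_gt0.
Qed.

(** The disk is invariant under rotations, and both terms of [dipole] are unchanged when [z] and [w]
    turn together. The rotation used carries the positive real axis to the ray of [z]. *)
Lemma integral_dipole_rotate h z : z.2 != 0 ->
  (\int[leb]_(w in D) (dipole h z w)%:E =
   \int[leb]_(w in D) (dipole h (Num.sqrt (z.1 ^+ 2 + z.2 ^+ 2), 0) w)%:E)%E.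
Proof.
move=> z20; have n0 : 0 < z.1 ^+ 2 + z.2 ^+ 2.
  by rewrite ltr_wpDl ?sqr_ge0// exprn_even_gt0.
set n := z.1 ^+ 2 + z.2 ^+ 2; set r := Num.sqrt n.
have r0 : 0 < r by rewrite sqrtr_gt0.
have rr : r ^+ 2 = n by rewrite sqr_sqrtr// ltW.
pose c := z.1 / r; pose s := z.2 / r.
have cs1 : c ^+ 2 + s ^+ 2 = 1.
  by rewrite /c /s !expr_div_n -mulrDl -/n -rr mulfV// gt_eqF// exprn_gt0.
have z1E : z.1 = c * r by rewrite /c divfK// gt_eqF.
have z2E : z.2 = s * r by rewrite /s divfK// gt_eqF.
rewrite integral_mkcond [RHS]integral_mkcond.
have s0 : s != 0 by rewrite /s mulf_neq0// invr_neq0// gt_eqF.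
have mG : measurable_fun setT ((fun w => (dipole h z w)%:E) \_ D).
  apply/(measurable_restrictT _ _).1 => //; first exact: measurable_Disk.
  by apply/measurable_EFinP; apply: measurable_funTS; exact: measurable_dipole.
have G0 w : (0 <= ((fun w => (dipole h z w)%:E) \_ D) w)%E.
  by apply: erestrict_ge0 => ? _; rewrite lee_fin dipole_ge0.
rewrite -[LHS](ge0_integral_rotation cs1 s0 mG G0).
have nrot w : (c * w.1 - s * w.2) ^+ 2 + (s * w.1 + c * w.2) ^+ 2 = w.1 ^+ 2 + w.2 ^+ 2.
  rewrite -[RHS]mul1r -cs1; ring.
apply: eq_integral => w _; rewrite /patch.
have -> : ((c * w.1 - s * w.2, s * w.1 + c * w.2) \in D) = (w \in D).
  by apply/idP/idP; rewrite !inE /Disk /= nrot.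
case: ifPn => // _; congr EFin; rewrite /dipole /sqrefl /sqdist /=.
rewrite z1E z2E nrot.
have -> : (c * w.1 - s * w.2 - c * r) ^+ 2 + (s * w.1 + c * w.2 - s * r) ^+ 2 =
   (c ^+ 2 + s ^+ 2) * ((w.1 - r) ^+ 2 + w.2 ^+ 2) by ring.
have -> : (c * w.1 - s * w.2) * (c * r) + (s * w.1 + c * w.2) * (s * r) =
   (c ^+ 2 + s ^+ 2) * (w.1 * r) by ring.
have -> : (c * r) ^+ 2 + (s * r) ^+ 2 = (c ^+ 2 + s ^+ 2) * r ^+ 2 by ring.
by rewrite cs1 !mul1r subr0 mulr0 addr0 expr0n /= addr0.
Qed.

Lemma integral_Disk_fubini (f : R * R -> R) : measurable_fun setT f ->
  (forall w, 0 <= f w) ->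
  (\int[leb]_(w in D) (f w)%:E = \int[mu]_y \int[mu]_x ((EFin \o f) \_ D) (x, y))%E.
Proof.
move=> mf f0; rewrite integral_mkcond /leb2 fubini_tonelli2//.
- apply/(measurable_restrictT _ _).1 => //; first exact: measurable_Disk.
  by apply/measurable_EFinP; exact: measurable_funTS.
- by move=> w; apply: erestrict_ge0 => ? _; rewrite lee_fin.
Qed.

(** After rotation the slice inequality is integrated over the height [y]. The height 0, which
    carries the singularities, is a null set, and lines with [y ^+ 2 >= 1] miss the disk. *)
Lemma integral_dipole_le h z : 0 <= h < 1 -> z.1 ^+ 2 + z.2 ^+ 2 < 1 -> z.2 != 0 ->
  (\int[leb]_(w in D) (dipole h z w)%:E <=
   2%:E * \int[leb]_(w in D) (sqdist (1, 0) w `^ (- h))%:E)%E.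
Proof.
move=> h01 z1 z20; rewrite integral_dipole_rotate//.
have n0 : 0 < z.1 ^+ 2 + z.2 ^+ 2.
  by rewrite ltr_wpDl ?sqr_ge0// exprn_even_gt0.
set r := Num.sqrt _; have r0 : 0 < r by rewrite sqrtr_gt0.
have r1 : r < 1 by rewrite -sqrtr1 ltr_sqrt.
have ms : measurable_fun setT (fun w => sqdist (1, 0) w `^ (- h)).
  by apply: measurable_powR_comp; exact: measurable_sqdist.
have s0 w : 0 <= sqdist (1, 0) w `^ (- h) by exact: powR_ge0.
have md : measurable_fun setT (dipole h (r, 0)) by exact: measurable_dipole.
have mrest (f : R * R -> R) : measurable_fun setT f -> measurable_fun setT ((EFin \o f) \_ D).
  move=> mf; apply/(measurable_restrictT _ _).1 => //; first exact: measurable_Disk.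
  by apply/measurable_EFinP; exact: measurable_funTS.
have rest0 (f : R * R -> R) w : (forall w, 0 <= f w) -> (0 <= ((EFin \o f) \_ D) w)%E.
  by move=> f0; apply: erestrict_ge0 => ? _; rewrite lee_fin.
have mG (f : R * R -> R) : measurable_fun setT f -> (forall w, 0 <= f w) ->
    measurable_fun setT (fun y => \int[mu]_x ((EFin \o f) \_ D) (x, y))%E.
  move=> mf f0.
  apply: (@measurable_fun_fubini_tonelli_G _ _ _ _ _ mu ((EFin \o f) \_ D)).
  - exact: mrest.
  - by move=> w; exact: rest0.
rewrite !integral_Disk_fubini//; last by move=> w; exact: dipole_ge0.
rewrite -ge0_integralZl//=; last 2 first.
- exact: mG.
- by move=> y _; apply: integral_ge0 => x _; exact: rest0.
apply: ae_ge0_le_integral => //.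
- by move=> y _; apply: integral_ge0 => x _; apply: rest0; exact: dipole_ge0.
- by apply: mG => //; exact: dipole_ge0.
- by move=> y _; rewrite mule_ge0//; apply: integral_ge0 => x _; exact: rest0.
- by apply: measurable_funeM; exact: mG.
exists [set 0]; split => //; first exact: lebesgue_measure_set1.
move=> y /=; apply: contra_notP => y0 _.
have {}y0 : y != 0 by apply/eqP.
have [y1|y1] := ltP (y ^+ 2) 1; last first.
  have H (f : R * R -> R) : (\int[mu]_x ((EFin \o f) \_ D) (x, y) = 0)%E.
    apply: integral0_eq => x _; rewrite /patch memNset// /Disk /=.
    by apply/negP; rewrite -leNgt (le_trans y1)// lerDr sqr_ge0.
  by rewrite !H mule0.
rewrite !integral_Disk_slice//; set a := Num.sqrt (1 - y ^+ 2).
have ay : a ^+ 2 + y ^+ 2 = 1 by rewrite sqr_sqrtr ?subrK// subr_ge0 ltW.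
have rr : 0 < r < 1 by rewrite r0.
have a0 : 0 <= a by exact: sqrtr_ge0.
have := slice_potential_le h01 y0 a0 ay rr.
congr (_ <= _)%E.
  rewrite -ge0_integralD//.
  - by apply: eq_integral => x _; rewrite dipole_axis.
  - by move=> x _; rewrite lee_fin powR_ge0.
  - apply/measurable_EFinP; apply: measurable_funTS.
    apply: (measurableT_comp (measurable_powR _)); apply: measurable_funD => //.
    by apply: measurable_funX; apply: measurable_funB.
  - by move=> x _; rewrite lee_fin powR_ge0.
  - apply/measurable_EFinP; apply: measurable_funTS.
    apply: (measurableT_comp (measurable_powR _)); apply: measurable_funD => //.
    by apply: measurable_funX; apply: measurable_funB.
by congr (_ * _)%E; apply: eq_integral => x _; rewrite /sqdist /= subr0.
Qed.

End DipolePotential.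

(** * Integrals of powers near 0 and reflection of the line *)

Section PowerIntegral.
Context {R : realType}.
Notation mu := (@lebesgue_measure R).

Lemma within_continuous_powR (k x y : R) : 0 < x ->
  {within `[x, y], continuous (fun u : R => u `^ k)}.
Proof.
move=> x0; apply: derivable_within_continuous => u /[!in_itv]/= /andP[xu _].
by have ? := is_derive1_powR k (lt_le_trans x0 xu); exact: ex_derive.
Qed.

Lemma integral_itv_powR (b x y : R) : b != 0 -> 0 < x <= y ->
  (\int[mu]_(u in `[x, y]) (u `^ (b - 1))%:E = ((y `^ b - x `^ b) / b)%:E)%E.
Proof.
move=> b0 /andP[x0 xy].
rewrite mulrBl; apply: (integral_itv_is_derive (F := fun u => u `^ b / b)) => //.
  move=> u /andP[xu _]; have ? := is_derive1_powR b (lt_le_trans x0 xu).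
  have -> : (u `^ (b - 1) = (b * u `^ (b - 1)) / b) by field.
  have := is_deriveM (is_derive1_powR b (lt_le_trans x0 xu)) (is_derive_cst b^-1 u 1).
  move=> /is_derive_eq; apply.
  by rewrite scaler0 add0r /GRing.scale /= mulrC.
exact: within_continuous_powR.
Qed.

(** The integrand may blow up at 0, so the interval is exhausted by [[c / (n + 1), c]] and the value
    follows by monotone convergence. *)
Lemma integral_powR0 (b c : R) : 0 < b -> 0 < c ->
  (\int[mu]_(u in `]0%R, c]) (u `^ (b - 1))%:E = (c `^ b / b)%:E)%E.
Proof.
move=> b0 c0; pose F (n : nat) : set R := `[c / n.+1%:R, c]%classic.
have mf : measurable_fun setT (fun u : R => (u `^ (b - 1))%:E).
  by apply/measurable_EFinP; exact: measurable_powR.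
have ndF : nondecreasing_seq F.
  apply/nondecreasing_seqP => n; apply/subsetPset => u; rewrite /F /= !in_itv/=.
  move=> /andP[+ ->]; rewrite andbT; apply: le_trans.
  by rewrite ler_pM2l// lef_pV2 ?posrE// ler_nat.
have cup : \bigcup_n F n = `]0, c]%classic.
  apply/seteqP; split=> [u [n _]|u]; rewrite /F /= !in_itv/=.
    by move=> /andP[+ ->]; rewrite andbT; apply: lt_le_trans; rewrite divr_gt0.
  move=> /andP[u0 uc]; exists (Num.truncn (c / u)) => //=; rewrite in_itv/= uc andbT.
  rewrite ler_pdivrMr// mulrC -ler_pdivrMr//.
  by rewrite ltW// truncnS_gt.
have H1 : (\int[mu]_(x in F n) (x `^ (b - 1))%:E @[n --> \oo] -->
    \int[mu]_(x in \bigcup_n F n) (x `^ (b - 1))%:E)%E.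
  apply: ge0_nondecreasing_set_cvg_integral => //.
  - by move=> n; exact: measurable_itv.
  - by move=> n; exact: measurable_funTS.
  - by move=> n x _; rewrite lee_fin powR_ge0.
rewrite cup in H1; apply: (cvg_unique _ H1) => //.
have -> : (fun n => \int[mu]_(x in F n) (x `^ (b - 1))%:E)%E =
    EFin \o (fun n : nat => (c `^ b - (c / n.+1%:R) `^ b) / b).
  apply/funext => n; rewrite integral_itv_powR ?gt_eqF//.
  by rewrite divr_gt0//= ler_pdivrMr// ler_pMr// ler1n.
apply: cvg_EFin; first by near=> n.
rewrite -[X in _ --> X / b]subr0; apply: cvgM; last exact: cvg_cst.
apply: cvgB; first exact: cvg_cst.
apply: (cvg_at_rightP (fun u => u `^ b) 0 0).1; first exact: powR_cvg0.
split=> [n|]; first by rewrite divr_gt0.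
rewrite -[X in _ --> X](mulr0 c); apply: cvgM; first exact: cvg_cst.
exact: cvg_harmonic.
Unshelve. all: by end_near. Qed.

Lemma ge0_integral_opp (f : R -> \bar R) : measurable_fun setT f ->
  (forall x, 0 <= f x)%E -> (\int[mu]_x f (- x)%R = \int[mu]_x f x)%E.
Proof.
move=> mf f0; have mN := @oppr_measurable R setT.
transitivity (\int[pushforward mu (-%R : R -> measurableTypeR R)]_x f x)%E.
  by rewrite ge0_integral_pushforward//.
by apply: eq_measure_integral => A mA _; exact: lebesgue_measureN.
Qed.

End PowerIntegral.

(** * The potential of the disk at the boundary point 1 *)

Section DiskPotential.
Context {R : realType}.
Notation mu := (@lebesgue_measure R).
Notation leb := (@leb2 R).
Notation D := (@Disk R).

(** Left in the extended reals: finiteness is deduced later from an identity with Gamma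
    integrals. *)
Definition Jint (s : R) : \bar R := (\int[mu]_t ((1 + t ^+ 2) `^ (- s))%:E)%E.

Lemma one_sqr_gt0 (t : R) : 0 < 1 + t ^+ 2.
Proof. by rewrite ltr_pwDl// sqr_ge0. Qed.

Lemma measurable_one_sqr (s : R) : measurable_fun setT (fun t : R => (1 + t ^+ 2) `^ s).
Proof.
apply: (measurableT_comp (measurable_powR _)).
by apply: measurable_funD => //; exact: measurable_funX.
Qed.

(* Integrate along the lines through the boundary point [1]: [y = (1 - x) t]. *)
Lemma integral_disk_potential (h : R) : 0 <= h < 1 ->
  (\int[leb]_(w in D) (sqdist (1, 0) w `^ (- h))%:E =
   (2 `^ (2 - 2 * h) / (2 - 2 * h))%:E * Jint (2 - h))%E.
Proof.
move=> /andP[h0 h1].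
have b0 : 0 < 2 - 2 * h by lra.
pose f (w : R * R) := sqdist (1, 0) w `^ (- h).
have mf : measurable_fun setT f.
  by apply: measurable_powR_comp; exact: measurable_sqdist.
pose G := (EFin \o f) \_ D.
have mG : measurable_fun setT G.
  apply/(measurable_restrictT _ _).1 => //; first exact: measurable_Disk.
  by apply/measurable_EFinP; exact: measurable_funTS.
have G0 w : (0 <= G w)%E by apply: erestrict_ge0 => ? _; rewrite lee_fin powR_ge0.
pose H x := (\int[mu]_y G (x, y))%E.
have mH : measurable_fun setT H.
  exact: (@measurable_fun_fubini_tonelli_F _ _ _ _ _ mu G).
have H0 x : (0 <= H x)%E by exact: integral_ge0.
(* With x = 1 - u and y = u t the disk condition reads u^2 (1 + t^2) < 2 u; it forces u > 0, and
   division by u gives [E]. *)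
pose E : set (R * R) := [set w | 0 < w.1 /\ w.1 * (1 + w.2 ^+ 2) < 2].
have mE : measurable E.
  have m1 : measurable_fun setT (fun w : R * R => w.1) by exact: measurable_fst.
  have m2 : measurable_fun setT (fun w : R * R => w.1 * (1 + w.2 ^+ 2)).
    by apply: measurable_funM => //; apply: measurable_funD => //; exact: measurable_funX.
  rewrite (_ : E = (setT `&` (fun w => w.1) @^-1` `]0, +oo[) `&`
      (setT `&` (fun w : R * R => w.1 * (1 + w.2 ^+ 2)) @^-1` `]-oo, 2[)).
    by apply: measurableI; [apply: m1|apply: m2].
  by apply/seteqP; split=> w; rewrite /E /= !in_itv/= andbT => -[]; [|case=> _ ? [_ ?]].
(* The Jacobian u times the density, the squared distance to 1 being u^2 (1 + t^2). *)
pose l (w : R * R) := w.1 `^ (1 - 2 * h) * (1 + w.2 ^+ 2) `^ (- h).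
have ml : measurable_fun setT l.
  apply: measurable_funM; first exact: (measurableT_comp (measurable_powR _)).
  exact: (measurableT_comp (measurable_one_sqr _)).
pose L := (EFin \o l) \_ E.
have mL : measurable_fun setT L.
  apply/(measurable_restrictT _ _).1 => //.
  by apply/measurable_EFinP; exact: measurable_funTS.
have L0 w : (0 <= L w)%E.
  by apply: erestrict_ge0 => ? _; rewrite lee_fin mulr_ge0 ?powR_ge0.
have HL (u : R) : (H (1 - u)%R = \int[mu]_t L (u, t))%E.
  have [u0|u0] := leP u 0.
    rewrite /H !integral0_eq// => t _.
      by rewrite /L /patch memNset// /E /= => -[]; rewrite ltNge u0.
    rewrite /G /patch memNset// /Disk /=; apply/negP; rewrite -leNgt.
    by have := sqr_ge0 t; nra.
  rewrite /H (@ge0_integral_affine _ u 0)//; last exact: measurableT_comp.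
  rewrite -ge0_integralZl//; last 2 first.
    apply: (measurableT_comp mG); apply: measurable_fun_pair => //.
    by apply: measurable_funD => //; exact: mulrl_measurable.
    by rewrite lee_fin ltW.
  apply: eq_integral => t _; rewrite addr0 /G /L /patch.
  have -> : ((1 - u, u * t) \in D) = ((u, t) \in E).
    have -> : (1 - u, u * t) \in D = (u * (u * (1 + t ^+ 2)) < u * 2).
      by apply/idP/idP; rewrite inE /Disk /=; lra.
    rewrite ltr_pM2l//; apply/idP/idP; rewrite inE /E /=; first by move=> ?; split.
    by case.
  case: ifPn => _; last by rewrite mule0.
  rewrite /= -EFinM /f /l /sqdist /=; congr EFin.
  have -> : (1 - u - 1) ^+ 2 + (u * t - 0) ^+ 2 = u ^+ 2 * (1 + t ^+ 2) by ring.
  rewrite powRM ?sqr_ge0// ?(ltW (one_sqr_gt0 t))// mulrA; congr (_ * _).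
  rewrite -powR_mulrn ?(ltW u0)// -powRrM.
  rewrite -[X in X * _ `^ _]powRr1 ?(ltW u0)// -powRD; last by apply/implyP => _; rewrite gt_eqF.
  by congr (_ `^ _); ring.
transitivity (\int[mu]_x H x)%E.
  by rewrite integral_mkcond /leb2 fubini_tonelli1.
rewrite -ge0_integral_opp//.
have mHN : measurable_fun setT (fun x : R => H (- x)).
  by apply: (measurableT_comp mH); exact: oppr_measurable.
rewrite -(ge0_integral_shift (- 1) mHN (fun x => H0 (- x))).
transitivity (\int[mu]_u \int[mu]_t L (u, t))%E.
  by apply: eq_integral => u _; rewrite -HL; congr H; ring.
rewrite fubini_tonelli// -ge0_integralZl//; last 3 first.
- by apply/measurable_EFinP; exact: measurable_one_sqr.
- by move=> t _; rewrite lee_fin powR_ge0.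
- by rewrite lee_fin divr_ge0 ?powR_ge0// ltW.
(* [c] is the value of [u] at which the line with parameter [t] leaves the disk. *)
apply: eq_integral => t _; pose c := 2 / (1 + t ^+ 2).
have t0 := one_sqr_gt0 t; have c0 : 0 < c by rewrite divr_gt0.
transitivity (\int[mu]_(u in `]0%R, c[) (l (u, t))%:E)%E.
  rewrite [RHS]integral_mkcond; apply: eq_integral => u _.
  rewrite /L /patch; congr (if _ then _ else _).
  by apply/idP/idP; rewrite !inE /E /= in_itv/= ltr_pdivlMr// => /andP.
have mlt : measurable_fun setT (fun u : R => (u `^ (2 - 2 * h - 1))%:E).
  by apply/measurable_EFinP; exact: measurable_powR.
rewrite /l /=; under eq_integral do rewrite mulrC EFinM.
rewrite ge0_integralZl//; last 3 first.
- apply: measurable_funTS; apply/measurable_EFinP; exact: measurable_powR.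
- by move=> u _; rewrite lee_fin powR_ge0.
- by rewrite lee_fin powR_ge0.
rewrite -(@integral_itv_bndoo _ _ _ _ false false); last first.
  apply: measurable_funTS; apply/measurable_EFinP; exact: measurable_powR.
have -> : 1 - 2 * h = (2 - 2 * h) - 1 by ring.
rewrite integral_powR0// -!EFinM; congr EFin.
rewrite /c powRM ?invr_ge0 ?(ltW t0)// -powR_inv1 ?(ltW t0)// -powRrM.
rewrite -mulrA mulrCA -!mulrA; congr (_ * _); rewrite mulrA [in RHS]mulrC; congr (_ * _).
rewrite -powRD; last by apply/implyP => _; rewrite gt_eqF.
by congr (_ `^ _); ring.
Qed.

End DiskPotential.

(** * Gamma integrals and the first evaluation of [Jint] *)

Section GammaIntegral.
Context {R : realType}.
Notation mu := (@lebesgue_measure R).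
Implicit Types (s a b : R).

(** The extended real version of [Gamma]: Tonelli's theorem yields identities for it before anything
    is known to be finite. *)
Definition gammae s : \bar R :=
  (\int[mu]_(t in `]0%R, +oo[) (t `^ (s - 1) * expR (- t))%:E)%E.

Lemma GammaE s : Gamma s = fine (gammae s).
Proof. by []. Qed.

Lemma measurable_gamma_density s k :
  measurable_fun setT (fun t : R => t `^ (s - 1) * expR (- (k * t))).
Proof.
apply: measurable_funM; first exact: measurable_powR.
apply: (measurableT_comp (@measurable_expR R)).
by apply: measurableT_comp => //; exact: mulrl_measurable.
Qed.

Lemma measurable_expRN : measurable_fun setT (fun t : R => expR (- t)).
Proof. by apply: (measurableT_comp (@measurable_expR R)); exact: oppr_measurable. Qed.

Lemma measurable_gamma_density1 s :
  measurable_fun setT (fun t : R => t `^ (s - 1) * expR (- t)).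
Proof.
by apply: measurable_funM; [exact: measurable_powR|exact: measurable_expRN].
Qed.

Lemma gammae_ge0 s : (0 <= gammae s)%E.
Proof. by apply: integral_ge0 => t _; rewrite lee_fin mulr_ge0 ?powR_ge0 ?expR_ge0. Qed.

Lemma gammae_scale s a : 0 < a ->
  (\int[mu]_(y in `]0%R, +oo[) (y `^ (s - 1) * expR (- (a * y)))%:E =
   (a `^ (- s))%:E * gammae s)%E.
Proof.
move=> a0; pose f t := ((fun t : R => (t `^ (s - 1) * expR (- (1 * t)))%:E) \_ `]0, +oo[) t.
have mf : measurable_fun setT f.
  apply/(measurable_restrictT _ _).1 => //.
  by apply/measurable_EFinP; apply: measurable_funTS; exact: measurable_gamma_density.
have f0 x : (0 <= f x)%E.
  by apply: erestrict_ge0 => ? _; rewrite lee_fin mulr_ge0 ?powR_ge0 ?expR_ge0.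
have -> : gammae s = (\int[mu]_x f x)%E.
  by rewrite /f -integral_mkcond; apply: eq_integral => t _; rewrite mul1r.
rewrite (@ge0_integral_affine _ a 0)// muleA -EFinM.
rewrite -ge0_integralZl//; last 2 first.
- by apply: (measurableT_comp mf); apply: measurable_funD => //; exact: mulrl_measurable.
- by rewrite lee_fin mulr_ge0 ?powR_ge0// ltW.
rewrite [LHS]integral_mkcond; apply: eq_integral => y _; rewrite /f addr0 /patch.
have -> : (a * y \in `]0, +oo[%classic) = (y \in `]0, +oo[%classic).
  by apply/idP/idP; rewrite !inE /= !in_itv /= !andbT pmulr_rgt0.
case: ifPn => [|_]; last by rewrite mule0.
rewrite inE/= in_itv/= andbT => y0; rewrite -EFinM mul1r; congr EFin.
rewrite powRM ?(ltW a0) ?(ltW y0)// -[X in _ `^ (- s) * X]powRr1 ?(ltW a0)//.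
rewrite !mulrA -!powRD; try by apply/implyP => _; rewrite gt_eqF.
have -> : - s + 1 + (s - 1) = 0 by ring.
by rewrite powRr0 mul1r.
Qed.

Lemma integral_gauss_scale y : 0 < y ->
  (\int[mu]_t (expR (- (y * t ^+ 2)))%:E = (Num.sqrt pi * y `^ (- 2^-1))%:E)%E.
Proof.
move=> y0; have sy : 0 < Num.sqrt y by rewrite sqrtr_gt0.
rewrite powRN powR12_sqrt ?ltW// EFinM -integralT_gauss.
rewrite [in RHS](@ge0_integral_affine _ (Num.sqrt y) 0)//; last 2 first.
- by apply/measurable_EFinP; exact: measurable_gauss_fun.
- by move=> x; rewrite lee_fin gauss_fun_ge0.
rewrite muleC muleA -EFinM mulVf ?gt_eqF// mul1e; apply: eq_integral => t _.
by rewrite addr0 /gauss_fun exprMn sqr_sqrtr// ltW.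
Qed.

(** The density y^(s-1) exp(-(1 + t^2) y) is integrated over y > 0 and real t in both orders.
    Integration in y gives the Gamma integral times (1 + t^2)^-s; integration in t is Gaussian, and
    its factor y^(-1/2) shifts the exponent. *)
Lemma gammae_Jint s : (gammae s * Jint s = (Num.sqrt pi)%:E * gammae (s - 2^-1))%E.
Proof.
pose k (w : R * R) := w.1 `^ (s - 1) * expR (- ((1 + w.2 ^+ 2) * w.1)).
pose E : set (R * R) := `]0, +oo[%classic `*` setT.
pose K := (EFin \o k) \_ E.
have mE : measurable E by apply: measurableX.
have mk : measurable_fun setT k.
  apply: measurable_funM; first exact: (measurableT_comp (measurable_powR _)).
  apply: (measurableT_comp (@measurable_expR R)).
  apply: measurableT_comp => //; apply: measurable_funM => //.
  by apply: measurable_funD => //; exact: measurable_funX.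
have mK : measurable_fun setT K.
  apply/(measurable_restrictT _ _).1 => //.
  by apply/measurable_EFinP; exact: measurable_funTS.
have K0 w : (0 <= K w)%E.
  by apply: erestrict_ge0 => ? _; rewrite lee_fin mulr_ge0 ?powR_ge0 ?expR_ge0.
have EE y t : ((y, t) \in E) = (y \in `]0, +oo[%classic).
  by apply/idP/idP; rewrite !inE /E /= => -[].
have := @fubini_tonelli _ _ _ _ _ mu mu _ mK K0.
have -> : (\int[mu]_t \int[mu]_y K (y, t) = gammae s * Jint s)%E.
  rewrite -ge0_integralZl//; last 3 first.
  - by apply/measurable_EFinP; exact: measurable_one_sqr.
  - by move=> t _; rewrite lee_fin powR_ge0.
  - exact: gammae_ge0.
  apply: eq_integral => t _; rewrite muleC -gammae_scale ?one_sqr_gt0//.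
  by rewrite [RHS]integral_mkcond; apply: eq_integral => y _; rewrite /K /patch EE.
move=> <-; rewrite -ge0_integralZl//; last 2 first.
- by apply: measurable_funTS; apply/measurable_EFinP; exact: measurable_gamma_density1.
- by move=> t _; rewrite lee_fin mulr_ge0 ?powR_ge0 ?expR_ge0.
rewrite [RHS]integral_mkcond; apply: eq_integral => y _; rewrite [RHS]/patch.
case: ifPn => [yp|yn]; last first.
  by rewrite integral0_eq// => t _; rewrite /K /patch EE (negbTE yn).
have y0 : 0 < y by move: yp; rewrite inE/= in_itv/= andbT.
transitivity (\int[mu]_t ((y `^ (s - 1) * expR (- y))%:E * (expR (- (y * t ^+ 2)))%:E))%E.
  apply: eq_integral => t _; rewrite /K /patch EE yp /k /= -EFinM; congr EFin.
  by rewrite -mulrA -expRD; congr (_ * expR _); ring.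
rewrite ge0_integralZl//; last 2 first.
- apply/measurable_EFinP; apply: (measurableT_comp (@measurable_expR R)).
  by apply: measurableT_comp => //; apply: measurable_funM => //; exact: measurable_funX.
- by rewrite lee_fin mulr_ge0 ?powR_ge0 ?expR_ge0.
rewrite integral_gauss_scale// -!EFinM; congr EFin.
have -> : s - 2^-1 - 1 = (s - 1) + (- 2^-1) by ring.
rewrite [y `^ (s - 1 - 2^-1)]powRD; last by apply/implyP => _; rewrite gt_eqF.
by rewrite mulrCA mulrAC.
Qed.

End GammaIntegral.

(** * Recurrence, positivity and finiteness of Gamma integrals *)

Section GammaRecurrence.
Context {R : realType}.
Notation mu := (@lebesgue_measure R).
Implicit Types (s a b : R).

Lemma integral_expR_tail (u : R) :
  (\int[mu]_(t in `[u, +oo[) (expR (- t))%:E = (expR (- u))%:E)%E.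
Proof.
have dF (x : R) : is_derive x 1 (fun t : R => - expR (- t)) (expR (- x)).
  have dN : is_derive x 1 (fun t : R => - t) (- 1) by exact: is_derive_eq.
  have := is_deriveN (is_derive1_comp (is_derive_expR (- x)) dN).
  by move=> /is_derive_eq; apply; rewrite mulrN1 opprK.
rewrite (@ge0_continuous_FTC2y _ _ (fun t => - expR (- t)) _ 0).
- by rewrite sub0e EFinN oppeK.
- by move=> x _; exact: expR_ge0.
- apply: continuous_subspaceT => x; apply: continuous_comp; first exact: opp_continuous.
  exact: continuous_expR.
- by rewrite -oppr0; apply: cvgN; exact: cvgr_expR.
- by move=> x _; have ? := dF x; exact: ex_derive.
- by apply: cvg_at_right_filter; have ? := dF u; exact: is_derive1_continuous.
- by move=> x _; rewrite derive1E; have ? := dF x; rewrite derive_val.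
Qed.

Lemma gammae1 : gammae (1 : R) = 1%E.
Proof.
rewrite /gammae; under eq_integral do rewrite subrr powRr0 mul1r.
rewrite integral_itv_obnd_cbnd; first by rewrite integral_expR_tail oppr0 expR0.
by apply: measurable_funTS; apply/measurable_EFinP; exact: measurable_expRN.
Qed.

(** In place of integration by parts, exp(-u) is written as the integral of exp(-t) over t >= u and
    the order is exchanged on the wedge 0 < u <= t, where u^(b-1) integrates to t^b / b. *)
Lemma gammaeS b : 0 < b -> gammae (b + 1) = (b%:E * gammae b)%E.
Proof.
move=> b0.
pose k (w : R * R) := w.1 `^ (b - 1) * expR (- w.2).
pose E : set (R * R) := [set w | 0 < w.1 /\ w.1 <= w.2].
pose K := (EFin \o k) \_ E.
have mE : measurable E.
  have m1 : measurable_fun setT (fun w : R * R => w.1) by exact: measurable_fst.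
  have m2 : measurable_fun setT (fun w : R * R => w.2 - w.1) by exact: measurable_funB.
  rewrite (_ : E = (setT `&` (fun w => w.1) @^-1` `]0, +oo[) `&`
      (setT `&` (fun w : R * R => w.2 - w.1) @^-1` `[0, +oo[)).
    by apply: measurableI; [apply: m1|apply: m2].
  by apply/seteqP; split=> w; rewrite /E /= !in_itv/= !andbT subr_ge0 => -[]; [|case=> _ ? [_ ?]].
have mk : measurable_fun setT k.
  apply: measurable_funM; first exact: (measurableT_comp (measurable_powR _)).
  exact: (measurableT_comp measurable_expRN).
have mK : measurable_fun setT K.
  apply/(measurable_restrictT _ _).1 => //.
  by apply/measurable_EFinP; exact: measurable_funTS.
have K0 w : (0 <= K w)%E.
  by apply: erestrict_ge0 => ? _; rewrite lee_fin mulr_ge0 ?powR_ge0 ?expR_ge0.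
have := @fubini_tonelli _ _ _ _ _ mu mu _ mK K0.
have -> : (\int[mu]_u \int[mu]_t K (u, t) = gammae b)%E.
  rewrite [RHS]integral_mkcond; apply: eq_integral => u _; rewrite [RHS]/patch.
  case: ifPn => [|un]; last first.
    rewrite integral0_eq// => t _; rewrite /K /patch memNset// /E /=.
    by move: un; rewrite notin_setE /= in_itv/= andbT => un [].
  rewrite inE/= in_itv/= andbT => u0.
  transitivity (\int[mu]_(t in `[u, +oo[) ((u `^ (b - 1))%:E * (expR (- t))%:E))%E.
    rewrite [RHS]integral_mkcond; apply: eq_integral => t _; rewrite /K /patch.
    have -> : ((u, t) \in E) = (t \in `[u, +oo[%classic).
      by apply/idP/idP; rewrite !inE /E /= in_itv/= andbT; [case|split].
    by case: ifPn.
  rewrite ge0_integralZl//; last 2 first.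
  - by apply: measurable_funTS; apply/measurable_EFinP; exact: measurable_expRN.
  - by rewrite lee_fin powR_ge0.
  - by rewrite integral_expR_tail.
move=> ->; rewrite -ge0_integralZl//; last 3 first.
- exact: (@measurable_fun_fubini_tonelli_G _ _ _ _ _ mu K).
- by move=> t _; exact: integral_ge0.
- by rewrite lee_fin ltW.
rewrite [LHS]integral_mkcond; apply: eq_integral => t _; rewrite [LHS]/patch.
case: ifPn => [|tn]; last first.
  rewrite integral0_eq ?mule0// => u _; rewrite /K /patch memNset// /E /=.
  move: tn; rewrite notin_setE /= in_itv/= andbT => tn [u0 ut].
  by apply: tn; exact: lt_le_trans ut.
rewrite inE/= in_itv/= andbT => t0.
transitivity (b%:E * \int[mu]_(u in `]0%R, t]) ((expR (- t))%:E * (u `^ (b - 1))%:E))%E.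
  rewrite ge0_integralZl//; last 2 first.
  - apply: measurable_funTS; apply/measurable_EFinP; exact: measurable_powR.
  - by move=> u _; rewrite lee_fin powR_ge0.
  rewrite integral_powR0// -!EFinM; congr EFin; rewrite addrK; field.
  by rewrite gt_eqF.
congr (_ * _)%E; rewrite [LHS]integral_mkcond; apply: eq_integral => u _.
rewrite /K /patch.
have -> : ((u, t) \in E) = (u \in `]0, t]%classic).
  by apply/idP/idP; rewrite !inE /E /= in_itv/= => /andP.
by case: ifPn => // _; rewrite /k /= EFinM muleC.
Qed.

(** On []0, 1]] the exponential is at least exp(-1), and the remaining power has integral 1 / s. *)
Lemma gammae_gt0 s : 0 < s -> (0 < gammae s)%E.
Proof.
move=> s0; apply: (@lt_le_trans _ _ ((expR (- 1))%:E * (1 `^ s / s)%:E)%E).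
  by rewrite -EFinM lte_fin mulr_gt0 ?expR_gt0// powR1 divr_gt0.
have mp : measurable_fun setT (fun u : R => (u `^ (s - 1))%:E).
  by apply/measurable_EFinP; exact: measurable_powR.
have md : measurable_fun setT (fun t : R => (t `^ (s - 1) * expR (- t))%:E).
  by apply/measurable_EFinP; exact: measurable_gamma_density1.
rewrite -integral_powR0// -ge0_integralZl//; last 2 first.
- exact: measurable_funTS.
- by move=> u _; rewrite lee_fin powR_ge0.
apply: (@le_trans _ _ (\int[mu]_(t in `]0%R, 1%R]) (t `^ (s - 1) * expR (- t))%:E)%E).
  apply: ge0_le_integral => //.
  - by move=> u _; rewrite -EFinM lee_fin mulr_ge0 ?expR_ge0 ?powR_ge0.
  - by apply: measurable_funeM; exact: measurable_funTS.
  - exact: measurable_funTS.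
  - move=> u /=; rewrite in_itv/= => /andP[u0 u1].
    by rewrite -EFinM lee_fin mulrC ler_wpM2l ?powR_ge0// ler_expR lerN2.
apply: ge0_subset_integral => //.
- exact: measurable_funTS.
- by move=> t _; rewrite lee_fin mulr_ge0 ?expR_ge0 ?powR_ge0.
- by apply: subset_itvl; rewrite bnd_simp.
Qed.

(** For [s <= 1] the integrand is dominated by its power factor on []0, 1]] and by its exponential
    factor beyond 1; the recurrence extends this to []1, 2]]. *)
Lemma gammae_lty s : 0 < s <= 2 -> (gammae s < +oo)%E.
Proof.
have H (t : R) : 0 < t <= 1 -> (gammae t < +oo)%E.
  move=> /andP[s0 s1]; rewrite /gammae.
  have mp : measurable_fun setT (fun u : R => (u `^ (t - 1))%:E).
    by apply/measurable_EFinP; exact: measurable_powR.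
  have me : measurable_fun setT (fun u : R => (expR (- u))%:E).
    by apply/measurable_EFinP; exact: measurable_expRN.
  have md : measurable_fun setT (fun u : R => (u `^ (t - 1) * expR (- u))%:E).
    by apply/measurable_EFinP; exact: measurable_gamma_density1.
  have d0 u : (0 <= (u `^ (t - 1) * expR (- u))%:E)%E.
    by rewrite lee_fin mulr_ge0 ?expR_ge0 ?powR_ge0.
  have -> : `]0, +oo[%classic = `]0, 1]%classic `|` `]1, +oo[%classic :> set R.
    by rewrite -itv_bndbnd_setU// bnd_simp.
  rewrite ge0_integral_setU//=; last 2 first.
  - exact: measurable_funTS.
  - apply/disj_setPS => u [] /=; rewrite !in_itv/= andbT => /andP[_ u1].
    by rewrite ltNge u1.
  apply: lte_add_pinfty.
    apply: (@le_lt_trans _ _ (1 `^ t / t)%:E); last exact: ltry.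
    rewrite -integral_powR0//; apply: ge0_le_integral => //.
    - exact: measurable_funTS.
    - exact: measurable_funTS.
    - move=> u /=; rewrite in_itv/= => /andP[u0 _].
      by rewrite lee_fin ler_piMr ?powR_ge0// -expR0 ler_expR oppr_le0 ltW.
  apply: (@le_lt_trans _ _ (expR (- 1))%:E); last exact: ltry.
  rewrite -integral_expR_tail -integral_itv_obnd_cbnd; last exact: measurable_funTS.
  apply: ge0_le_integral => //.
  - exact: measurable_funTS.
  - exact: measurable_funTS.
  - move=> u /=; rewrite in_itv/= andbT => u1.
    rewrite lee_fin ler_piMl ?expR_ge0// -[leRHS](powRr0 u).
    by apply: ler_powR; [exact: ltW|rewrite subr_le0].
move=> /andP[s0 s2]; have [s1|s1] := leP s 1; first by apply: H; rewrite s0.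
have -> : s = s - 1 + 1 by rewrite subrK.
rewrite gammaeS ?subr_gt0// lte_mul_pinfty// ?lee_fin ?subr_ge0 ?ltW//.
by apply: H; rewrite subr_gt0 s1 lerBlDr.
Qed.

End GammaRecurrence.

(** * The square of a Gamma integral as a folded Beta integral *)

Section GammaSquare.
Context {R : realType}.
Notation mu := (@lebesgue_measure R).
Variable a : R.

Let g (t : R) : \bar R := ((fun t : R => (t `^ (a - 1) * expR (- t))%:E) \_ `]0, +oo[) t.

Let mg : measurable_fun setT g.
Proof.
apply/(measurable_restrictT _ _).1 => //.
by apply: measurable_funTS; apply/measurable_EFinP; exact: measurable_gamma_density1.
Qed.

Let g0 t : (0 <= g t)%E.
Proof. by apply: erestrict_ge0 => ? _; rewrite lee_fin mulr_ge0 ?powR_ge0 ?expR_ge0. Qed.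

Let gE t : 0 < t -> g t = (t `^ (a - 1) * expR (- t))%:E.
Proof. by move=> t0; rewrite /g /patch mem_set//= in_itv/= t0. Qed.

Let gN t : t <= 0 -> g t = 0%E.
Proof. by move=> t0; rewrite /g /patch memNset//= in_itv/= andbT; apply/negP; rewrite -leNgt. Qed.

Let gammaeg : gammae a = (\int[mu]_t g t)%E.
Proof. by rewrite /g -integral_mkcond. Qed.

(** For [I] equal to []0, +oo[] this is the Beta integral B(a, a) in the variable t = x / y; a
    smaller [I] selects a cone of the quadrant. *)
Let T (I : set R) : \bar R :=
  (\int[mu]_(t in I) (t `^ (a - 1) * (1 + t) `^ (- (2 * a)))%:E)%E.

(* Slicing a cone [x / y \in I] of the quadrant by the rays [x = t y]. *)
Let cone (I : set R) : measurable I -> I `<=` `]0, +oo[%classic ->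
  (\int[mu]_y \int[mu]_x (g x * g y * (\1_I (x / y))%:E) = gammae (2 * a) * T I)%E.
Proof.
move=> mI I0.
pose k (w : R * R) := w.1 `^ (a - 1) * (w.2 `^ (2 * a - 1) * expR (- ((1 + w.1) * w.2))).
pose E : set (R * R) := I `*` `]0, +oo[%classic.
pose K := (EFin \o k) \_ E.
have mE : measurable E by exact: measurableX.
have mk : measurable_fun setT k.
  apply: measurable_funM; first exact: (measurableT_comp (measurable_powR _)).
  apply: measurable_funM; first exact: (measurableT_comp (measurable_powR _)).
  apply: (measurableT_comp measurable_expRN); apply: measurable_funM => //.
  exact: measurable_funD.
have mK : measurable_fun setT K.
  apply/(measurable_restrictT _ _).1 => //.
  by apply/measurable_EFinP; exact: measurable_funTS.
have K0 w : (0 <= K w)%E.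
  by apply: erestrict_ge0 => ? _; rewrite lee_fin !mulr_ge0 ?powR_ge0 ?expR_ge0.
transitivity (\int[mu]_y \int[mu]_t K (t, y))%E.
  apply: eq_integral => y _; have [y0|y0] := leP y 0.
    rewrite !integral0_eq// => x _; last by rewrite (gN y0) mule0 mul0e.
    by rewrite /K /patch memNset// /E /= => -[_]; rewrite in_itv/= andbT ltNge y0.
  rewrite (@ge0_integral_affine _ y 0)//; last 2 first.
  - apply: emeasurable_funM.
      by apply: emeasurable_funM => //; exact: measurable_cst.
    apply/measurable_EFinP; apply: measurableT_comp; first exact: measurable_indic.
    exact: mulrr_measurable.
  - by move=> x; rewrite !mule_ge0// lee_fin.
  rewrite -ge0_integralZl//; last 3 first.
  - apply: emeasurable_funM.
      apply: emeasurable_funM; last exact: measurable_cst.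
      by apply: (measurableT_comp mg); apply: measurable_funD => //; exact: mulrl_measurable.
    apply/measurable_EFinP; apply: measurableT_comp; first exact: measurable_indic.
    apply: (measurableT_comp (@mulrr_measurable _ setT y^-1)).
    by apply: measurable_funD => //; exact: mulrl_measurable.
  - by move=> x _; rewrite !mule_ge0// lee_fin.
  - by rewrite lee_fin ltW.
  apply: eq_integral => t _; rewrite addr0 (mulrC y) mulfK ?gt_eqF//.
  rewrite /K /patch.
  have -> : ((t, y) \in E) = (t \in I).
    by apply/idP/idP; rewrite !inE /E /= in_itv/= andbT; [case|split].
  rewrite indicE; case: ifPn => [tI|_]; last by rewrite !mule0.
  have t0 : 0 < t by move: tI; rewrite inE => /I0; rewrite /= in_itv/= andbT.
  rewrite mule1 gE ?mulr_gt0// gE// -!EFinM /k /=; congr EFin.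
  rewrite powRM ?(ltW t0) ?(ltW y0)//.
  have -> : y `^ (2 * a - 1) = y * y `^ (a - 1) * y `^ (a - 1).
    rewrite -[X in X * _ * _]powRr1 ?(ltW y0)// -!powRD; try by apply/implyP => _; rewrite gt_eqF.
    by congr (_ `^ _); ring.
  have -> : - ((1 + t) * y) = - (t * y) + - y by ring.
  by rewrite expRD; ring.
rewrite -fubini_tonelli// [T I]integral_mkcond -ge0_integralZl//; last 3 first.
- apply/(measurable_restrictT _ _).1 => //; apply: measurable_funTS.
  apply/measurable_EFinP; apply: measurable_funM; first exact: measurable_powR.
  by apply: (measurableT_comp (measurable_powR _)); exact: measurable_funD.
- by move=> t _; apply: erestrict_ge0 => ? _; rewrite lee_fin mulr_ge0 ?powR_ge0.
- exact: gammae_ge0.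
apply: eq_integral => t _; rewrite [in RHS]/patch; case: ifPn => [tI|tI]; last first.
  rewrite mule0 integral0_eq// => y _; rewrite /K /patch memNset// /E /= => -[].
  by move: tI; rewrite notin_setE.
have t0 : 0 < t by move: tI; rewrite inE => /I0; rewrite /= in_itv/= andbT.
have t1 : 0 < 1 + t by rewrite addr_gt0.
transitivity ((t `^ (a - 1))%:E * (((1 + t) `^ (- (2 * a)))%:E * gammae (2 * a)))%E; last first.
  by rewrite muleA -EFinM muleC.
rewrite -(gammae_scale _ t1) -ge0_integralZl//; last 3 first.
- apply: measurable_funTS; apply/measurable_EFinP; exact: measurable_gamma_density.
- by move=> y _; rewrite lee_fin mulr_ge0 ?powR_ge0 ?expR_ge0.
- by rewrite lee_fin powR_ge0.
rewrite [RHS]integral_mkcond; apply: eq_integral => y _; rewrite /K /patch.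
have -> : ((t, y) \in E) = (y \in `]0, +oo[%classic).
  apply/idP/idP; rewrite !inE /E /=; first by case.
  by split => //; move: tI; rewrite inE.
by case: ifPn.
Qed.

(** The quadrant is cut along the diagonal, and exchanging the coordinates brings both halves to
    quotients at least 1. This folds the Beta integral onto [[1, +oo[], the range that the
    substitution of the next section maps onto [[0, +oo[]. *)
Lemma gammae_sqr : (gammae a * gammae a = 2%:E * (gammae (2 * a) *
  \int[mu]_(t in `[1%R, +oo[) (t `^ (a - 1) * (1 + t) `^ (- (2 * a)))%:E))%E.
Proof.
pose K (w : R * R) := (g w.1 * g w.2)%E.
have mK : measurable_fun setT K.
  by apply: emeasurable_funM; exact: measurableT_comp.
have K0 w : (0 <= K w)%E by exact: mule_ge0.
pose E : set (R * R) := [set w | 0 < w.1 - w.2].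
have mE : measurable E.
  have m2 : measurable_fun setT (fun w : R * R => w.1 - w.2) by exact: measurable_funB.
  rewrite (_ : E = setT `&` (fun w : R * R => w.1 - w.2) @^-1` `]0, +oo[).
    by apply: m2.
  by apply/seteqP; split=> w; rewrite /E /= in_itv/= andbT => -[].
have -> : (gammae a * gammae a = \int[@leb2 R]_w K w)%E.
  rewrite /leb2 fubini_tonelli2// {2}gammaeg -ge0_integralZl//; last exact: gammae_ge0.
  apply: eq_integral => y _; rewrite /fubini_G /K /= ge0_integralZr// gammaeg.
  by [].
rewrite -(setUv E) ge0_integral_setU//=; last 3 first.
- exact: measurableC.
- exact: measurable_funTS.
- by apply/disj_setPS => w [].
have mT : measurable_fun setT (fun t : R => (t `^ (a - 1) * (1 + t) `^ (- (2 * a)))%:E).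
  apply/measurable_EFinP; apply: measurable_funM; first exact: measurable_powR.
  by apply: (measurableT_comp (measurable_powR _)); exact: measurable_funD.
have mr (F : set (R * R)) : measurable F -> measurable_fun setT (K \_ F).
  by move=> mF; apply/(measurable_restrictT _ _).1 => //; exact: measurable_funTS.
have r0 (F : set (R * R)) w : (0 <= (K \_ F) w)%E by exact: erestrict_ge0.
have H1 : (\int[@leb2 R]_(w in E) K w = gammae (2 * a) * T `]1%R, +oo[)%E.
  rewrite -cone//; last by apply: subset_itvr; rewrite bnd_simp.
  rewrite [LHS]integral_mkcond /leb2 fubini_tonelli2//; last exact: mr.
  apply: eq_integral => y _; apply: eq_integral => x _; rewrite /patch indicE.
  have [y0|y0] := leP y 0.
    by rewrite /K /= (gN y0) !mule0 mul0e if_same.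
  have -> : ((x, y) \in E) = (x / y \in `]1, +oo[%classic).
    by apply/idP/idP; rewrite !inE /E /= in_itv/= andbT ltr_pdivlMr// mul1r subr_gt0.
  by case: ifPn => _; rewrite ?mule1 ?mule0.
(* On the complement the quotient is the second coordinate over the first, hence the other order of
   integration; the diagonal accounts for the closed end point 1. *)
have H2 : (\int[@leb2 R]_(w in ~` E) K w = gammae (2 * a) * T `[1%R, +oo[)%E.
  rewrite -cone//; last by move=> t /=; rewrite !in_itv/= !andbT; exact: lt_le_trans.
  rewrite [LHS]integral_mkcond /leb2 fubini_tonelli1//; last by apply: mr; exact: measurableC.
  apply: eq_integral => y _; apply: eq_integral => x _; rewrite /patch indicE.
  have [y0|y0] := leP y 0.
    by rewrite /K /= (gN y0) !mule0 !mul0e if_same.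
  have -> : ((y, x) \in ~` E) = (x / y \in `[1, +oo[%classic).
    apply/idP/idP; rewrite !inE /E /= in_itv/= andbT ler_pdivlMr// mul1r subr_gt0.
      by move/negP; rewrite -leNgt.
    by move=> h; apply/negP; rewrite -leNgt.
  by case: ifPn => _; rewrite ?mule1 ?mule0// /K /= muleC.
rewrite H1 H2 /T integral_itv_obnd_cbnd; last exact: measurable_funTS.
by rewrite mule_natl mule2n.
Qed.

End GammaSquare.

(** * The substitution linking [Jint] with the folded Beta integral *)

Section Substitution.
Context {R : realType}.
Notation mu := (@lebesgue_measure R).

Lemma powR_cvgy (k : R) : 0 < k -> x `^ k @[x --> +oo] --> +oo.
Proof.
move=> k0; apply/cvgryPge => A; near=> x.
apply: (@le_trans _ _ (`|A| + 1)); first by rewrite (le_trans (ler_norm A))// lerDl.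
have A0 : 0 <= `|A| + 1 by rewrite addr_ge0.
rewrite -[leLHS](powRr1 A0) -(mulVf (lt0r_neq0 k0)) powRrM.
apply: ge0_ler_powR; [exact: ltW|by rewrite nnegrE powR_ge0| |].
- by rewrite nnegrE; near: x; exact: nbhs_pinfty_ge.
- by near: x; exact: nbhs_pinfty_ge.
Unshelve. all: by end_near. Qed.

Lemma powRN_cvg0 (k : R) : 0 < k -> x `^ (- k) @[x --> +oo] --> 0.
Proof.
move=> k0; have -> : (fun x : R => x `^ (- k)) = (fun x => (x `^ k)^-1).
  by apply/funext => x; rewrite powRN.
apply/gtr0_cvgV0; last exact: powR_cvgy.
near=> x; rewrite powR_gt0//; near: x; exact: nbhs_pinfty_gt.
Unshelve. all: by end_near. Qed.

Lemma continuous_powR (k t : R) : 0 < t -> {for t, continuous (fun x : R => x `^ k)}.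
Proof.
move=> t0; apply: (is_derive1_continuous (d := k * t `^ (k - 1))).
exact: is_derive1_powR.
Qed.

(** This is sinh((ln t) / 2) for t > 0. It maps [[1, +oo[] onto [[0, +oo[], and 1 + F(t)^2 = (1 +
    t)^2 / (4 t) turns powers of 1 + F^2 into powers of t and of 1 + t. *)
Let F (t : R) : R := (t `^ 2^-1 - t `^ (- 2^-1)) / 2.
Let dF (t : R) : R := (t `^ (- 2^-1) + t `^ (- (2^-1 + 1))) / 4.

Let is_derive_F (t : R) : 0 < t -> is_derive t 1 F (dF t).
Proof.
move=> t0; have := is_deriveM (is_deriveB (is_derive1_powR 2^-1 t0)
  (is_derive1_powR (- 2^-1) t0)) (is_derive_cst (2^-1 : R) t 1).
move=> /is_derive_eq; apply; rewrite scaler0 add0r /GRing.scale /= /dF.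
have -> : 2^-1 - 1 = - 2^-1 :> R by field.
have -> : - 2^-1 - 1 = - (2^-1 + 1) :> R by ring.
by field.
Qed.

Let derive_F (t : R) : 0 < t -> F^`()%classic t = dF t.
Proof. by move=> t0; have ? := is_derive_F t0; rewrite derive1E derive_val. Qed.

Let continuous_dF (t : R) : 0 < t -> {for t, continuous dF}.
Proof.
move=> t0; apply: cvgM; last exact: cvg_cst.
by apply: cvgD; exact: continuous_powR.
Qed.

Let continuous_F' (t : R) : 0 < t -> {for t, continuous F^`()%classic}.
Proof.
move=> t0; suff : F^`()%classic x @[x --> t] --> F^`()%classic t by [].
rewrite derive_F//.
apply: cvg_trans (continuous_dF t0); apply: (near_eq_cvg (f := dF) (g := F^`()%classic)); near=> x.
by rewrite derive_F//; near: x; exact: lt_nbhsr.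
Unshelve. all: by end_near. Qed.

Lemma integral_one_sqr_half (a : R) :
  (\int[mu]_(t in `[0%R, +oo[) ((1 + t ^+ 2) `^ (- (a + 2^-1)))%:E =
   (4 `^ (a - 2^-1))%:E *
   \int[mu]_(t in `[1%R, +oo[) (t `^ (a - 1) * (1 + t) `^ (- (2 * a)))%:E)%E.
Proof.
have F1 : F 1 = 0 by rewrite /F !powR1 subrr mul0r.
rewrite -{1}F1 (increasing_ge0_integration_by_substitutiony (F := F)).
- rewrite -ge0_integralZl//; last 2 first.
  + apply: measurable_funTS; apply/measurable_EFinP.
    apply: measurable_funM; first exact: measurable_powR.
    by apply: (measurableT_comp (measurable_powR _)); exact: measurable_funD.
  + by move=> t _; rewrite lee_fin mulr_ge0 ?powR_ge0.
  apply: eq_integral => t; rewrite inE /= in_itv/= andbT => t1.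
  have t0 : 0 < t by exact: lt_le_trans t1.
  have u0 : 0 < 1 + t by rewrite addr_gt0.
  rewrite -EFinM; congr EFin; rewrite !fctE derive_F//.
  have tV : t `^ (- 2^-1) = (t `^ 2^-1)^-1 by rewrite powRN.
  have tt : (t `^ 2^-1) ^+ 2 = t by rewrite powR12_sqrt ?sqr_sqrtr ?(ltW t0).
  have p0 : 0 < t `^ 2^-1 by rewrite powR_gt0.
  have -> : 1 + F t ^+ 2 = 4 `^ (- 1) * ((1 + t) `^ 2 * t `^ (- 1)).
    rewrite /F tV !powR_inv1 ?(ltW t0)// powR_mulrn ?(ltW u0)// -[in RHS]tt.
    by field; rewrite gt_eqF.
  have -> : dF t = 4 `^ (- 1) * ((1 + t) * t `^ (- 1) * t `^ (- 2^-1)).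
    rewrite /dF opprD powRD; last by apply/implyP => _; rewrite gt_eqF.
    by rewrite !powR_inv1 ?(ltW t0)//; field; rewrite gt_eqF.
  rewrite !powRM ?mulr_ge0 ?powR_ge0// -!powRrM.
  rewrite -[X in _ * (_ * (X * _ * _))]powRr1 ?(ltW u0)//.
  transitivity ((4 `^ (-1 * - (a + 2^-1)) * 4 `^ (- 1)) *
    (((1 + t) `^ (2 * - (a + 2^-1)) * (1 + t) `^ 1) *
     (t `^ (-1 * - (a + 2^-1)) * t `^ (- 1) * t `^ (- 2^-1)))); first by ring.
  rewrite -!powRD; try by apply/implyP => _; rewrite gt_eqF.
  rewrite [(1 + t) `^ _ * _ in LHS]mulrC.
  by congr (_ `^ _ * (_ `^ _ * _ `^ _)); field.
- move=> x y; rewrite !in_itv/= !andbT => x1 y1 xy.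
  have x0 : 0 < x by exact: lt_le_trans x1.
  have y0 : 0 < y by exact: lt_le_trans y1.
  have pxy : x `^ 2^-1 < y `^ 2^-1.
    by apply: gt0_ltr_powR; rewrite ?nnegrE ?(ltW x0) ?(ltW y0).
  rewrite /F ltr_pM2r// ltrB// !powRN ltf_pV2 ?posrE ?powR_gt0//.
- by move=> t; rewrite in_itv/= andbT => t1; apply: continuous_F'; exact: lt_trans t1.
- by apply/cvg_ex; exists (F^`()%classic 1); apply: cvg_at_right_filter; exact: continuous_F'.
- apply/cvg_ex; exists 0; apply: cvg_trans.
    apply: (near_eq_cvg (f := dF) (g := F^`()%classic)); near=> x.
    by rewrite derive_F//; near: x; exact: nbhs_pinfty_gt.
  rewrite -(mul0r (4^-1 : R)); apply: cvgM; last exact: cvg_cst.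
  by rewrite -(addr0 (0 : R)); apply: cvgD; exact: powRN_cvg0.
- split=> [t|].
    rewrite in_itv/= andbT => t1; have ? := is_derive_F (lt_trans ltr01 t1).
    exact: ex_derive.
  by apply: cvg_at_right_filter; apply: is_derive1_continuous; exact: is_derive_F.
- apply/cvgryPge => A; near=> x.
  have x1 : 1 <= x by near: x; exact: nbhs_pinfty_ge.
  have : x `^ (- 2^-1) <= 1.
    by rewrite -[leRHS](powRr0 x); apply: ler_powR.
  have : 2 * A + 1 <= x `^ 2^-1.
    by near: x; apply: (cvgryPge _).1; apply: powR_cvgy.
  by rewrite /F; lra.
- apply: continuous_subspaceT => t.
  apply: (@continuous_comp _ _ _ (fun t : R => 1 + t ^+ 2) (fun u => u `^ (- (a + 2^-1)))).
    by apply: cvgD; [exact: cvg_cst|exact: exprn_continuous].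
  by apply: is_derive1_continuous; apply: is_derive1_powR; exact: one_sqr_gt0.
- by move=> t _; exact: powR_ge0.
Unshelve. all: by end_near. Qed.

End Substitution.

(** * The potential at 1 in terms of Gamma *)

Section DiskPotentialValue.
Context {R : realType}.
Notation mu := (@lebesgue_measure R).
Notation leb := (@leb2 R).
Notation D := (@Disk R).

Lemma gammaeE (s : R) : 0 < s <= 2 -> gammae s = (Gamma s)%:E.
Proof.
move=> s02; rewrite GammaE fineK// ge0_fin_numE ?gammae_ge0//.
exact: gammae_lty.
Qed.

Lemma Gamma_gt0 (s : R) : 0 < s <= 2 -> 0 < Gamma s.
Proof.
move=> s02; rewrite -lte_fin -gammaeE//; apply: gammae_gt0.
by case/andP: s02.
Qed.

Lemma GammaS (s : R) : 0 < s <= 1 -> Gamma (s + 1) = s * Gamma s.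
Proof.
move=> /andP[s0 s1]; apply: EFin_inj; rewrite EFinM -!gammaeE ?gammaeS//.
- by rewrite s0 (le_trans s1)// ler1n.
- by rewrite addr_gt0//=; lra.
Qed.

Lemma Gamma1 : Gamma 1 = 1 :> R.
Proof. by rewrite GammaE gammae1. Qed.

Lemma Jint_half (s : R) :
  (Jint s = 2%:E * \int[mu]_(t in `[0%R, +oo[) ((1 + t ^+ 2) `^ (- s))%:E)%E.
Proof.
rewrite /Jint ge0_symfun_integralT.
- by rewrite set_itvcy.
- by move=> x; exact: powR_ge0.
- move=> t; apply: (@continuous_comp _ _ _ (fun t : R => 1 + t ^+ 2) (fun u => u `^ (- s))).
    by apply: cvgD; [exact: cvg_cst|exact: exprn_continuous].
  by apply: continuous_powR; exact: one_sqr_gt0.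
- by move=> t /=; rewrite sqrrN.
Qed.

(** [Gamma] is finite and positive on []0, 2]], so the first identity already shows that [Jint] is
    finite and positive. The bound [a <= 1] keeps [a + 2^-1] and [2 * a] in that range. *)
Lemma Gamma_Jint (a : R) : 0 < a <= 1 -> exists2 j : R, 0 < j &
  [/\ Jint (a + 2^-1) = j%:E, Gamma (a + 2^-1) * j = Num.sqrt pi * Gamma a &
      4 `^ (a - 2^-1) * Gamma a ^+ 2 = Gamma (2 * a) * j].
Proof.
move=> /andP[a0 a1].
have aI : 0 < a <= 2 by rewrite a0 (le_trans a1)// ler1n.
have sI : 0 < a + 2^-1 <= 2 by apply/andP; split; lra.
have dI : 0 < 2 * a <= 2 by apply/andP; split; lra.
have := gammae_Jint (a + 2^-1); rewrite addrK !gammaeE// -EFinM => J1.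
have J0 : (0 <= Jint (a + 2^-1))%E.
  by apply: integral_ge0 => t _; rewrite lee_fin powR_ge0.
have Jfin : Jint (a + 2^-1) \is a fin_num.
  move: J1 J0; case: (Jint _) => // J1 _.
  by move: J1; rewrite gt0_muley// lte_fin Gamma_gt0.
rewrite -(fineK Jfin) in J1 *; set j := fine _ in J1 *.
move: J1; rewrite -EFinM => -[J1].
have j0 : 0 < j.
  have : 0 < Gamma (a + 2^-1) * j.
    by rewrite J1 mulr_gt0 ?Gamma_gt0// sqrtr_gt0 pi_gt0.
  by rewrite pmulr_rgt0// Gamma_gt0.
exists j => //; split => //.
have c0 : 0 < 4 `^ (a - 2^-1) :> R by exact: powR_gt0.
have := gammae_sqr a; have := Jint_half (a + 2^-1).
rewrite integral_one_sqr_half; set T := (\int[_]_(_ in _) _)%E.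
rewrite !gammaeE// -(fineK Jfin) -/j => JT GT.
apply: EFin_inj; rewrite expr2 EFinM EFinM GT EFinM JT.
by rewrite muleCA [in RHS]muleCA; congr (_ * _)%E; rewrite muleCA.
Qed.

(** At a = 1/2 the two identities share the term [Gamma 1 * j]; equating them leaves Gamma(1/2)^2 =
    sqrt(pi) Gamma(1/2). *)
Lemma Gamma_half : Gamma 2^-1 = Num.sqrt pi :> R.
Proof.
have h01 : 0 < (2^-1 : R) <= 1 by apply/andP; split; lra.
have [j j0 [_]] := Gamma_Jint h01.
have -> : 2^-1 + 2^-1 = 1 :> R by field.
rewrite subrr powRr0 mulfV// Gamma1 !mul1r => -> /eqP.
have g0 : Gamma 2^-1 != 0 :> R.
  by rewrite gt_eqF//; apply: Gamma_gt0; apply/andP; split; lra.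
by rewrite expr2 -subr_eq0 -mulrBl mulf_eq0 (negbTE g0) orbF subr_eq0 => /eqP.
Qed.

Lemma disk_potential_value (h : R) : 2^-1 <= h < 1 ->
  (\int[leb]_(w in D) (sqdist (1, 0) w `^ (- h))%:E =
   (pi * (Gamma (2 - 2 * h) / Gamma (2 - h) ^+ 2))%:E)%E.
Proof.
move=> /andP[h0 h1].
have h01 : 0 <= h < 1 by rewrite h1 andbT; lra.
(* The choice a = 3/2 - h makes a + 1/2 equal to 2 - h, the exponent left by the integration along
   lines. *)
have aI : 0 < 3 / 2 - h <= 1 by apply/andP; split; lra.
have [j j0] := Gamma_Jint aI.
have -> : 3 / 2 - h + 2^-1 = 2 - h by field.
have -> : 2 * (3 / 2 - h) = (2 - 2 * h) + 1 by field.
have -> : 3 / 2 - h - 2^-1 = 1 - h by field.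
have bI : 0 < 2 - 2 * h <= 1 by apply/andP; split; lra.
rewrite GammaS//.
have -> : 4 `^ (1 - h) = 2 `^ (2 - 2 * h) :> R.
  have -> : 4 = 2 `^ 2 :> R by rewrite powR_mulrn// -natrX.
  by rewrite -powRrM; congr (_ `^ _); ring.
move=> [JE J1 J2]; rewrite integral_disk_potential// JE -EFinM; congr EFin.
have g0 : 0 < Gamma (2 - h) by apply: Gamma_gt0; apply/andP; split; lra.
(* Squared, the first identity contains Gamma(3/2 - h)^2, which the second one replaces; one power
   of [j] then cancels. *)
have J3 : Gamma (2 - h) ^+ 2 * j ^+ 2 = pi * Gamma (3 / 2 - h) ^+ 2.
  by rewrite -exprMn J1 exprMn sqr_sqrtr ?pi_ge0.
have b0 : 0 < 2 - 2 * h by case/andP: bI.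
set C := 2 `^ _ in J2 *; set b := 2 - 2 * h in J2 b0 *.
have jn : j != 0 by rewrite gt_eqF.
have J4 : C * Gamma (2 - h) ^+ 2 * j = pi * (b * Gamma b).
  apply: (mulIf jn); transitivity (C * (Gamma (2 - h) ^+ 2 * j ^+ 2)); first by ring.
  by rewrite J3 mulrCA J2; ring.
have -> : C = pi * (b * Gamma b) / (Gamma (2 - h) ^+ 2 * j).
  by rewrite -J4; field; rewrite jn gt_eqF.
by field; rewrite jn !gt_eqF.
Qed.

End DiskPotentialValue.

(** * Modulus, measurability and the pointwise bound of the kernel *)

Section ComplexValued.
Context {R : realType}.
Local Notation C := R[i].
Implicit Types (f g phi : R * R -> C) (x y : C) (z w : R * R).

Lemma cmodE x : cmod x = Normc.normc x.
Proof. by case: x. Qed.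

Lemma cmod_ge0 x : 0 <= cmod x.
Proof. exact: sqrtr_ge0. Qed.

Lemma cmodM x y : cmod (x * y) = cmod x * cmod y.
Proof. by rewrite !cmodE Normc.normcM. Qed.

Lemma cmodV x : cmod x^-1 = (cmod x)^-1.
Proof. by rewrite !cmodE Normc.normcV. Qed.

Lemma cmodN x : cmod (- x) = cmod x.
Proof. by rewrite !cmodE normcN. Qed.

Lemma cmodD x y : cmod (x + y) <= cmod x + cmod y.
Proof. by rewrite !cmodE; exact: le_normcD. Qed.

Lemma cmodJ x : cmod (conjc x) = cmod x.
Proof. by case: x => a b; rewrite /cmod /= sqrrN. Qed.

Lemma cmod_ge_Re x : `|complex.Re x| <= cmod x.
Proof. by rewrite /cmod -sqrtr_sqr ler_sqrt ?addr_ge0 ?sqr_ge0// lerDl sqr_ge0. Qed.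

Lemma cmod_ge_Im x : `|complex.Im x| <= cmod x.
Proof. by rewrite /cmod -sqrtr_sqr ler_sqrt ?addr_ge0 ?sqr_ge0// lerDr sqr_ge0. Qed.

Lemma cmod_toC z : cmod (toC z) = Num.sqrt (z.1 ^+ 2 + z.2 ^+ 2).
Proof. by []. Qed.

Lemma cmod_sub z w : cmod (toC w - toC z) = Num.sqrt (sqdist z w).
Proof. by []. Qed.

Lemma cmod_refl z w : cmod (1 - conjc (toC w) * toC z) = Num.sqrt (sqrefl z w).
Proof. by rewrite sqreflE /cmod /=; congr Num.sqrt; ring. Qed.

Definition cmeas f := measurable_fun setT (fun w => complex.Re (f w)) /\
  measurable_fun setT (fun w => complex.Im (f w)).

Lemma cmeas_cst x : cmeas (fun=> x).
Proof. by split; exact: measurable_cst. Qed.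

Lemma cmeas_toC : cmeas (@toC R).
Proof. by split; [exact: measurable_fst|exact: measurable_snd]. Qed.

Lemma cmeasD f g : cmeas f -> cmeas g -> cmeas (fun w => f w + g w).
Proof.
move=> [f1 f2] [g1 g2]; split.
- rewrite (_ : (fun _ => _) = (fun w => complex.Re (f w) + complex.Re (g w))).
    exact: measurable_funD.
  by apply/funext => w; case: (f w) => ? ?; case: (g w).
- rewrite (_ : (fun _ => _) = (fun w => complex.Im (f w) + complex.Im (g w))).
    exact: measurable_funD.
  by apply/funext => w; case: (f w) => ? ?; case: (g w).
Qed.

Lemma cmeasN f : cmeas f -> cmeas (fun w => - f w).
Proof.
move=> [f1 f2]; split.
- rewrite (_ : (fun _ => _) = (fun w => - complex.Re (f w))).
    exact: measurable_funN.
  by apply/funext => w; case: (f w).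
- rewrite (_ : (fun _ => _) = (fun w => - complex.Im (f w))).
    exact: measurable_funN.
  by apply/funext => w; case: (f w).
Qed.

Lemma cmeasJ f : cmeas f -> cmeas (fun w => conjc (f w)).
Proof.
move=> [f1 f2]; split.
- rewrite (_ : (fun _ => _) = (fun w => complex.Re (f w)))//.
  by apply/funext => w; case: (f w).
- rewrite (_ : (fun _ => _) = (fun w => - complex.Im (f w))).
    exact: measurable_funN.
  by apply/funext => w; case: (f w).
Qed.

Lemma cmeasM f g : cmeas f -> cmeas g -> cmeas (fun w => f w * g w).
Proof.
move=> [f1 f2] [g1 g2]; split.
- rewrite (_ : (fun _ => _) = (fun w => complex.Re (f w) * complex.Re (g w) -
      complex.Im (f w) * complex.Im (g w))).
    by apply: measurable_funB; exact: measurable_funM.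
  by apply/funext => w; case: (f w) => ? ?; case: (g w).
- rewrite (_ : (fun _ => _) = (fun w => complex.Re (f w) * complex.Im (g w) +
      complex.Im (f w) * complex.Re (g w))).
    by apply: measurable_funD; exact: measurable_funM.
  by apply/funext => w; case: (f w) => ? ?; case: (g w).
Qed.

(** The inverse squared modulus is written as a power with exponent -1, to which measurability of
    powers applies; at 0 both conventions give 0. *)
Lemma cmeasV f : cmeas f -> cmeas (fun w => (f w)^-1).
Proof.
move=> [f1 f2].
have mn : measurable_fun setT
    (fun w => (complex.Re (f w) ^+ 2 + complex.Im (f w) ^+ 2) `^ (- 1)).
  by apply: measurable_powR_comp; apply: measurable_funD; exact: measurable_funX.
split.
- rewrite (_ : (fun _ => _) = (fun w => complex.Re (f w) *
      (complex.Re (f w) ^+ 2 + complex.Im (f w) ^+ 2) `^ (- 1))).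
    exact: measurable_funM.
  by apply/funext => w; rewrite powR_inv1 ?addr_ge0 ?sqr_ge0//; case: (f w).
- rewrite (_ : (fun _ => _) = (fun w => - (complex.Im (f w) *
      (complex.Re (f w) ^+ 2 + complex.Im (f w) ^+ 2) `^ (- 1)))).
    by apply: measurable_funN; exact: measurable_funM.
  by apply/funext => w; rewrite powR_inv1 ?addr_ge0 ?sqr_ge0//; case: (f w).
Qed.

Lemma cmeas_cmod f : cmeas f -> measurable_fun setT (fun w => cmod (f w)).
Proof.
move=> [f1 f2].
rewrite (_ : (fun _ => _) = (fun w =>
    (complex.Re (f w) ^+ 2 + complex.Im (f w) ^+ 2) `^ 2^-1)).
  by apply: measurable_powR_comp; apply: measurable_funD; exact: measurable_funX.
by apply/funext => w; rewrite powR12_sqrt ?addr_ge0 ?sqr_ge0.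
Qed.

Definition kern phi z w : C := phi w / (toC w - toC z)
  + toC z * conjc (phi w) / (1 - conjc (toC w) * toC z).

Lemma PcauchyE phi z : Pcauchy phi z = - cint (kern phi z).
Proof. by []. Qed.

Lemma cmeas_kern phi z : cmeas phi -> cmeas (kern phi z).
Proof.
move=> mphi; apply: cmeasD.
  apply: cmeasM => //; apply: cmeasV; apply: (cmeasD cmeas_toC).
  exact: cmeas_cst.
apply: cmeasM; first by apply: cmeasM; [exact: cmeas_cst|exact: cmeasJ].
apply: cmeasV; apply: (cmeasD (cmeas_cst 1)); apply: cmeasN.
by apply: cmeasM; [apply: cmeasJ; exact: cmeas_toC|exact: cmeas_cst].
Qed.

Definition kern_bound z w : R := (Num.sqrt (sqdist z w))^-1
  + Num.sqrt (z.1 ^+ 2 + z.2 ^+ 2) * (Num.sqrt (sqrefl z w))^-1.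

Lemma kern_bound_ge0 z w : 0 <= kern_bound z w.
Proof. by rewrite addr_ge0 ?mulr_ge0 ?invr_ge0 ?sqrtr_ge0. Qed.

Lemma cmod_kern_le phi z w : cmod (kern phi z w) <= cmod (phi w) * kern_bound z w.
Proof.
apply: (le_trans (cmodD _ _)).
rewrite !cmodM !cmodV cmodJ cmod_sub cmod_refl cmod_toC /kern_bound.
by rewrite mulrDr [X in _ + X * _]mulrC -[X in _ + X]mulrA.
Qed.

Lemma sqrt_inv_powR (s q : R) : 0 <= s -> (Num.sqrt s)^-1 `^ q = s `^ (- (q / 2)).
Proof.
move=> s0; rewrite -powR12_sqrt// -powRN -powRrM; congr (_ `^ _).
by rewrite mulNr mulrC.
Qed.

Lemma measurable_kern_bound z : measurable_fun setT (kern_bound z).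
Proof.
rewrite (_ : kern_bound z = (fun w => sqdist z w `^ (- 2^-1) +
    Num.sqrt (z.1 ^+ 2 + z.2 ^+ 2) * sqrefl z w `^ (- 2^-1))).
  apply: measurable_funD; first by apply: measurable_powR_comp; exact: measurable_sqdist.
  apply: measurable_funM; first exact: measurable_cst.
  by apply: measurable_powR_comp; exact: measurable_sqrefl.
apply/funext => w; rewrite /kern_bound !powRN !powR12_sqrt ?sqdist_ge0 ?sqrefl_ge0//.
Qed.

(** Convexity in the form of Hoelder's inequality for the pairs (x, y) and (1, 1). The exponent
    conjugate to 1 is infinite, hence the separate case [q = 1]. *)
Lemma powRD_le (x y q : R) : 0 <= x -> 0 <= y -> 1 <= q ->
  (x + y) `^ q <= 2 `^ (q - 1) * (x `^ q + y `^ q).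
Proof.
move=> x0 y0 q1; have q0 : 0 < q by exact: lt_le_trans q1.
have [->|q1'] := eqVneq q 1.
  by rewrite subrr powRr0 mul1r !powRr1 ?addr_ge0.
have q2 : 1 < q by rewrite lt_neqAle eq_sym q1' q1.
pose p := q / (q - 1).
have p0 : 0 < p by rewrite divr_gt0// subr_gt0.
have qn : q != 0 by rewrite gt_eqF.
have qn1 : q - 1 != 0 by rewrite subr_eq0.
have pq : q^-1 + p^-1 = 1 by rewrite /p; field; rewrite ?qn ?qn1.
have := hoelder2 x0 y0 ler01 ler01 q0 p0 pq.
rewrite !mulr1 !powR1 => H.
have := ge0_ler_powR (ltW q0) _ _ H.
rewrite !nnegrE => /(_ (addr_ge0 x0 y0) (mulr_ge0 (powR_ge0 _ _) (powR_ge0 _ _))).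
rewrite powRM ?powR_ge0// -!powRrM mulVf ?gt_eqF// powRr1 ?addr_ge0 ?powR_ge0//.
rewrite mulrC; congr (_ <= _ `^ _ * _).
by rewrite /p; field; rewrite ?qn ?qn1.
Qed.

Lemma kern_bound_powR_le z w (q : R) : 1 <= q ->
  kern_bound z w `^ q <= 2 `^ (q - 1) * dipole (q / 2) z w.
Proof.
move=> q1; apply: le_trans (powRD_le _ _ q1) _.
- by rewrite invr_ge0 sqrtr_ge0.
- by rewrite mulr_ge0 ?invr_ge0 ?sqrtr_ge0.
rewrite powRM ?invr_ge0 ?sqrtr_ge0// !sqrt_inv_powR ?sqdist_ge0 ?sqrefl_ge0//.
rewrite -[Num.sqrt _]powR12_sqrt ?addr_ge0 ?sqr_ge0// -powRrM.
by rewrite [2^-1 * q]mulrC.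
Qed.

End ComplexValued.

(** * Integral bounds for the kernel and for the transform *)

Section UpperBound.
Context {R : realType}.
Notation leb := (@leb2 R).
Notation D := (@Disk R).
Notation dA := (@dA R).
Local Notation C := R[i].
Implicit Types (f g phi : R * R -> C) (x y : C) (z w : R * R).

(** The potential of the disk at 1 for the normalized area measure. *)
Definition potential_one (q : R) : R := Gamma (2 - q) / Gamma (2 - q / 2) ^+ 2.

Lemma potential_one_gt0 q : 1 <= q < 2 -> 0 < potential_one q.
Proof.
move=> /andP[q1 q2]; rewrite divr_gt0 ?exprn_gt0//; apply: Gamma_gt0.
  by apply/andP; split; lra.
by apply/andP; split; lra.
Qed.

Lemma ge0_integral_dA (E : set (R * R)) (f : R * R -> \bar R) : measurable E ->
  measurable_fun E f -> (forall w, E w -> 0 <= f w)%E ->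
  (\int[dA]_(w in E) f w = (pi^-1)%:E * \int[leb]_(w in E) f w)%E.
Proof. by move=> mE mf f0; rewrite ge0_integral_mscale. Qed.

Lemma integral_dA_potential q : 1 <= q < 2 ->
  (\int[dA]_(w in D) (sqdist (1, 0) w `^ (- (q / 2)))%:E = (potential_one q)%:E)%E.
Proof.
move=> /andP[q1 q2]; rewrite ge0_integral_dA; last 3 first.
- exact: measurable_Disk.
- apply: measurable_funTS; apply/measurable_EFinP.
  by apply: measurable_powR_comp; exact: measurable_sqdist.
- by move=> w _; rewrite lee_fin powR_ge0.
rewrite disk_potential_value; last by apply/andP; split; lra.
have pin : (pi : R) != 0 by rewrite gt_eqF// pi_gt0.
rewrite [2 * _]mulrC divfK// -/(potential_one q) -EFinM; congr EFin.
exact: mulKf.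
Qed.

Lemma integral_kern_bound q z : 1 <= q < 2 -> z.1 ^+ 2 + z.2 ^+ 2 < 1 -> z.2 != 0 ->
  (\int[dA]_(w in D) (kern_bound z w `^ q)%:E <= (2 `^ q * potential_one q)%:E)%E.
Proof.
move=> q12 zD z20; have /andP[q1 q2] := q12.
have mD := @measurable_Disk R.
apply: (@le_trans _ _ (\int[dA]_(w in D) ((2 `^ (q - 1))%:E * (dipole (q / 2) z w)%:E))%E).
  apply: ge0_le_integral => //.
  - by move=> w _; rewrite lee_fin powR_ge0.
  - apply: measurable_funTS; apply/measurable_EFinP.
    by apply: measurable_powR_comp; exact: measurable_kern_bound.
  - apply: measurable_funTS; apply: measurable_funeM; apply/measurable_EFinP.
    exact: measurable_dipole.
  - by move=> w _; rewrite -EFinM lee_fin; exact: kern_bound_powR_le.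
have md : measurable_fun D (fun w => (dipole (q / 2) z w)%:E).
  by apply: measurable_funTS; apply/measurable_EFinP; exact: measurable_dipole.
have d0 w : (0 <= (dipole (q / 2) z w)%:E)%E by rewrite lee_fin dipole_ge0.
rewrite ge0_integralZl// ge0_integral_dA//.
have hI : 0 <= q / 2 < 1 by apply/andP; split; lra.
have := integral_dipole_le hI zD z20.
rewrite disk_potential_value; last by apply/andP; split; lra.
rewrite [2 * (q / 2)]mulrC divfK// -/(potential_one q) => H.
have -> : 2 `^ q * potential_one q =
    2 `^ (q - 1) * (pi^-1 * (2 * (pi * potential_one q))).
  have -> : 2 `^ q = 2 `^ (q - 1) * 2 :> R.
    rewrite -[X in _ * X]powRr1// -powRD ?subrK//.
    by apply/implyP => _.
  have pin : (pi : R) != 0 by rewrite gt_eqF// pi_gt0.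
  by rewrite [pi^-1 * _]mulrCA mulKf//; exact: esym (mulrA _ _ _).
rewrite EFinM lee_pmul2l ?lte_fin ?powR_gt0// EFinM.
by rewrite lee_pmul2l ?lte_fin ?invr_gt0 ?pi_gt0// EFinM.
Qed.

Lemma cauchy_schwarz2 (a b c d : R) :
  a * c + b * d <= Num.sqrt (a ^+ 2 + b ^+ 2) * Num.sqrt (c ^+ 2 + d ^+ 2).
Proof.
rewrite -sqrtrM ?addr_ge0 ?sqr_ge0//; apply: (le_trans (ler_norm _)).
rewrite -sqrtr_sqr ler_sqrt ?mulr_ge0 ?addr_ge0 ?sqr_ge0//.
by rewrite -subr_ge0; have := sqr_ge0 (a * d - b * c); congr (_ <= _); ring.
Qed.

Lemma cint_integrable f : cmeas f -> (\int[dA]_(w in D) (cmod (f w))%:E < +oo)%E ->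
  dA.-integrable D (EFin \o (fun w => complex.Re (f w))) /\
  dA.-integrable D (EFin \o (fun w => complex.Im (f w))).
Proof.
move=> mf foo; have mD := @measurable_Disk R.
have mcm : measurable_fun setT (fun w => cmod (f w)) by exact: cmeas_cmod.
have icm : dA.-integrable D (EFin \o (fun w => cmod (f w))).
  apply/integrableP; split; first by apply: measurable_funTS; exact/measurable_EFinP.
  by under eq_integral do rewrite /= ger0_norm ?cmod_ge0//.
case: mf => mf1 mf2; split.
- apply: le_integrable icm => //; first by apply: measurable_funTS; exact/measurable_EFinP.
  by move=> w _; rewrite /= lee_fin (ger0_norm (cmod_ge0 _)) cmod_ge_Re.
- apply: le_integrable icm => //; first by apply: measurable_funTS; exact/measurable_EFinP.
  by move=> w _; rewrite /= lee_fin (ger0_norm (cmod_ge0 _)) cmod_ge_Im.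
Qed.

(** If the integral is X + iY with modulus n, then n^2 is the integral of X Re f + Y Im f, hence at
    most n times the integral of |f|; for n > 0 one factor n cancels. *)
Lemma cmod_cint_le f : cmeas f -> (\int[dA]_(w in D) (cmod (f w))%:E < +oo)%E ->
  ((cmod (cint f))%:E <= \int[dA]_(w in D) (cmod (f w))%:E)%E.
Proof.
move=> mf foo; have mD := @measurable_Disk R.
have [i1 i2] := cint_integrable mf foo.
have c0 : (0 <= \int[dA]_(w in D) (cmod (f w))%:E)%E.
  by apply: integral_ge0 => w _; rewrite lee_fin cmod_ge0.
rewrite -[leRHS]fineK ?ge0_fin_numE// lee_fin.
have icm : dA.-integrable D (EFin \o (fun w => cmod (f w))).
  apply/integrableP; split.
    by apply: measurable_funTS; apply/measurable_EFinP; exact: cmeas_cmod.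
  by under eq_integral do rewrite /= ger0_norm ?cmod_ge0//.
set X := Rintegral dA D (fun w => complex.Re (f w)).
set Y := Rintegral dA D (fun w => complex.Im (f w)).
have -> : cint f = (X +i* Y)%C by [].
set n := cmod (X +i* Y)%C.
have nn : n ^+ 2 = X ^+ 2 + Y ^+ 2 by rewrite /n /cmod sqr_sqrtr ?addr_ge0 ?sqr_ge0.
have [n0|n0] := leP n 0; first by rewrite (le_trans n0)// fine_ge0.
rewrite -(ler_pM2l n0) -expr2 nn !expr2 -[X in _ <= _ * X]/(Rintegral dA D (fun w => cmod (f w))).
have iZ (k : R) (g : R * R -> R) : dA.-integrable D (EFin \o g) ->
    dA.-integrable D (EFin \o (fun w => k * g w)).
  move=> ig; have H : dA.-integrable D (fun w => k%:E * (EFin \o g) w)%E.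
    by apply: integrableZl.
  exact: H.
have iX := iZ X _ i1; have iY := iZ Y _ i2.
rewrite -!RintegralZl// -RintegralD//.
apply: le_Rintegral => //.
- have H : dA.-integrable D ((EFin \o (fun w => (X * complex.Re (f w))%R)) \+
      (EFin \o (fun w => (Y * complex.Im (f w))%R)))%E by apply: integrableD.
  exact: H.
- exact: iZ.
- by move=> w _; exact: cauchy_schwarz2.
Qed.

(** Finiteness is recorded beside the bound because the lower bound needs it again, to integrate an
    inequality on the imaginary part of the kernel. *)
Lemma pointwise_bound phi z (c : R) : cmeas phi ->
  (\int[dA]_(w in D) (cmod (phi w) * kern_bound z w)%:E <= c%:E)%E ->
  (\int[dA]_(w in D) (cmod (kern phi z w))%:E < +oo)%E /\ cmod (Pcauchy phi z) <= c.
Proof.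
move=> mphi H; have mD := @measurable_Disk R.
have L : (\int[dA]_(w in D) (cmod (kern phi z w))%:E <= c%:E)%E.
  apply: le_trans H; apply: ge0_le_integral => //.
  - by move=> w _; rewrite lee_fin cmod_ge0.
  - apply: measurable_funTS; apply/measurable_EFinP; apply: cmeas_cmod.
    exact: cmeas_kern.
  - apply: measurable_funTS; apply/measurable_EFinP; apply: measurable_funM.
      exact: cmeas_cmod.
    exact: measurable_kern_bound.
  - by move=> w _; rewrite lee_fin; exact: cmod_kern_le.
have foo := le_lt_trans L (ltry c).
split=> //; rewrite PcauchyE cmodN -lee_fin.
by apply: le_trans L; apply: cmod_cint_le => //; exact: cmeas_kern.
Qed.

End UpperBound.

(** * The upper bound for the operator norm *)

Section OperatorUpperBound.
Context {R : realType}.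
Notation D := (@Disk R).
Notation dA := (@dA R).
Implicit Types (phi : R * R -> R[i]) (z w : R * R).

Lemma integral_indic_Disk (f : R * R -> \bar R) (g : R * R -> \bar R) :
  (forall w, D w -> f w = g w) -> (forall w, ~ D w -> f w = 0%E) ->
  (\int[dA]_w f w = \int[dA]_(w in D) g w)%E.
Proof.
move=> fg f0; rewrite [RHS]integral_mkcond; apply: eq_integral => w _.
rewrite /patch; case: ifPn => [|]; first by rewrite inE => /fg.
by rewrite notin_setE => /f0.
Qed.

Lemma indic_DiskE (w : R * R) (c : R) : D w -> \1_D w * c = c.
Proof. by move=> wD; rewrite indicE mem_set// mul1r. Qed.

Lemma indic_DiskN (w : R * R) (c : R) : ~ D w -> \1_D w * c = 0.
Proof. by move=> wD; rewrite indicE memNset// mul0r. Qed.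

Lemma Lnorm_kern_bound q z : 1 <= q < 2 -> z.1 ^+ 2 + z.2 ^+ 2 < 1 -> z.2 != 0 ->
  (Lnorm dA q%:E (fun w => (\1_D w * kern_bound z w)%:E) <=
   (2 * potential_one q `^ q^-1)%:E)%E.
Proof.
move=> q12 zD z20; have /andP[q1 q2] := q12.
have q0 : 0 < q by exact: lt_le_trans q1.
rewrite unlock.
have -> : (\int[dA]_x `|(\1_D x * kern_bound z x)%:E| `^ q =
    \int[dA]_(w in D) (kern_bound z w `^ q)%:E)%E.
  apply: integral_indic_Disk => w wD /=.
    by rewrite indic_DiskE// ger0_norm// kern_bound_ge0.
  by rewrite indic_DiskN// normr0 powR0// gt_eqF.
have H := integral_kern_bound q12 zD z20.
apply: (@le_trans _ _ ((2 `^ q * potential_one q)%:E `^ q^-1)%E).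
  apply: gt0_ler_poweR => //; rewrite ?invr_ge0 ?(ltW q0)// in_itv/= leey andbT.
    by apply: integral_ge0 => w _; rewrite lee_fin powR_ge0.
  by rewrite lee_fin mulr_ge0 ?powR_ge0// ltW// potential_one_gt0.
rewrite poweR_EFin lee_fin powRM ?powR_ge0// ?(ltW (potential_one_gt0 q12))//.
by rewrite -powRrM mulfV ?gt_eqF// powRr1.
Qed.

Lemma measurable_indic_Disk (f : R * R -> R) : measurable_fun setT f ->
  measurable_fun setT (fun w => \1_D w * f w).
Proof.
move=> mf; apply: measurable_funM => //.
by apply: measurable_indic; exact: measurable_Disk.
Qed.

Lemma integral_phi_kern p q phi z : 0 < p -> p^-1 + q^-1 = 1 -> 1 <= q < 2 ->
  unit_Lp p%:E phi -> z.1 ^+ 2 + z.2 ^+ 2 < 1 -> z.2 != 0 ->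
  (\int[dA]_(w in D) (cmod (phi w) * kern_bound z w)%:E <=
   (2 * potential_one q `^ q^-1)%:E)%E.
Proof.
move=> p0 pq q12 [m1 [m2 n1]] zD z20; have /andP[q1 q2] := q12.
have q0 : 0 < q by exact: lt_le_trans q1.
pose f w := \1_D w * cmod (phi w); pose g w := \1_D w * kern_bound z w.
have mf : measurable_fun setT f by apply: measurable_indic_Disk; exact: cmeas_cmod.
have mg : measurable_fun setT g.
  by apply: measurable_indic_Disk; exact: measurable_kern_bound.
have := @hoelder _ _ _ dA f g p q mf mg p0 q0 pq.
have -> : Lnorm dA p%:E (EFin \o f) = 1%E by rewrite -n1.
rewrite mul1e Lnorm1 => H.
apply: le_trans (Lnorm_kern_bound q12 zD z20).
apply: le_trans H; rewrite le_eqVlt; apply/orP; left; apply/eqP/esym.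
apply: integral_indic_Disk => w wD /=.
  by rewrite /f /g !indic_DiskE// ger0_norm// mulr_ge0 ?cmod_ge0 ?kern_bound_ge0.
by rewrite /f /g !indic_DiskN// mul0r normr0.
Qed.

Lemma dA_prod (A B : set R) : measurable A -> measurable B ->
  (dA (A `*` B) = (pi^-1)%:E * (@lebesgue_measure R A * @lebesgue_measure R B))%E.
Proof.
by move=> mA mB; rewrite -(@product_measure1E _ _ _ _ _ lebesgue_measure lebesgue_measure).
Qed.

Lemma dA_rect_gt0 (a b c d : R) : a < b -> c < d ->
  (0 < dA (`]a, b[%classic `*` `]c, d[%classic))%E.
Proof.
move=> ab cd; rewrite dA_prod// !lebesgue_measure_itv/= !lte_fin ab cd.
by rewrite lte_fin !mulr_gt0 ?invr_gt0 ?pi_gt0 ?subr_gt0.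
Qed.

(** At exponent [+oo], [Lnorm] is an essential supremum only when the whole space has positive
    measure. *)
Lemma dA_setT_gt0 : (0 < dA setT)%E.
Proof.
apply: lt_le_trans (dA_rect_gt0 ltr01 ltr01) _.
by apply: le_measure => //; rewrite inE//; exact: measurableX.
Qed.

(** This is what allows the essential supremum of the transform to disregard real [z], to which the
    rotation argument does not apply. *)
Lemma dA_axis : dA.-negligible [set w | w.2 = 0].
Proof.
exists (setT `*` [set 0]); split.
- exact: measurableX.
- rewrite dA_prod//.
  by rewrite lebesgue_measure_set1 mule0 mule0.
- by move=> [x y] /= ->.
Qed.

(** The conjugate exponent is 1: almost everywhere on the disk |phi| is at most 1, and only the
    integral of the kernel bound remains. *)
Lemma integral_phi_kern_oo phi z : unit_Lp +oo%E phi ->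
  z.1 ^+ 2 + z.2 ^+ 2 < 1 -> z.2 != 0 ->
  (\int[dA]_(w in D) (cmod (phi w) * kern_bound z w)%:E <=
   (2 * potential_one 1)%:E)%E.
Proof.
move=> [m1 [m2 n1]] zD z20; have mD := @measurable_Disk R.
have q12 : 1 <= (1 : R) < 2 by rewrite lexx ltr1n.
apply: le_trans (_ : \int[dA]_(w in D) (kern_bound z w `^ 1)%:E <= _)%E; last first.
  by have := integral_kern_bound q12 zD z20; rewrite powRr1.
apply: ae_ge0_le_integral => //.
- by move=> w _; rewrite lee_fin mulr_ge0 ?cmod_ge0 ?kern_bound_ge0.
- apply: measurable_funTS; apply/measurable_EFinP; apply: measurable_funM.
    exact: cmeas_cmod.
  exact: measurable_kern_bound.
- by move=> w _; rewrite lee_fin powR_ge0.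
- apply: measurable_funTS; apply/measurable_EFinP.
  by apply: measurable_powR_comp; exact: measurable_kern_bound.
move: n1; rewrite /normD unlock dA_setT_gt0 => n1.
have := ess_sup_ge dA (abse \o (fun w => (\1_D w * cmod (phi w))%:E)).
rewrite n1; apply: filterS => w /= + wD.
rewrite indic_DiskE// lee_fin ger0_norm ?cmod_ge0// => h.
by rewrite lee_fin powRr1 ?kern_bound_ge0// ler_piMl ?kern_bound_ge0.
Qed.

Lemma opnorm_le (p : \bar R) (c : R) : 0 <= c ->
  (forall phi z, unit_Lp p phi -> z.1 ^+ 2 + z.2 ^+ 2 < 1 -> z.2 != 0 ->
    (\int[dA]_(w in D) (cmod (phi w) * kern_bound z w)%:E <= c%:E)%E) ->
  (opnorm p <= c%:E)%E.
Proof.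
move=> c0 H; apply: ge_ereal_sup => _ [phi uphi <-].
rewrite /normD unlock; case: ifPn => // _; apply/ess_supP.
apply: (negligibleS _ dA_axis) => z /=; apply: contra_notP => z20.
have {}z20 : z.2 != 0 by apply/eqP.
have [zD|zD] := pselect (D z); last by rewrite indic_DiskN// normr0 lee_fin.
rewrite indic_DiskE// ger0_norm ?cmod_ge0// lee_fin.
have [mm1 [mm2 _]] := uphi.
by apply: (proj2 (pointwise_bound _ (H _ _ uphi zD z20))).
Qed.

End OperatorUpperBound.

(** * Truncated extremal functions near the point 1 *)

Section Extremal.
Context {R : realType}.
Notation D := (@Disk R).
Notation dA := (@dA R).
Notation s1 := (@sqdist R (1, 0)).
Implicit Types (z w : R * R).

Definition cut_disk (d : R) : set (R * R) := [set w | D w /\ d ^+ 2 < s1 w].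

Lemma measurable_cut_disk d : measurable (cut_disk d).
Proof.
rewrite (_ : cut_disk d = D `&` (setT `&` s1 @^-1` `]d ^+ 2, +oo[)).
  apply: measurableI; first exact: measurable_Disk.
  by apply: (@measurable_sqdist R (1, 0)).
apply/seteqP; split=> w; rewrite /cut_disk /= in_itv/= andbT.
  by move=> [].
by move=> [? [_ ?]].
Qed.

Lemma dA_cut_disk_gt0 d : 0 < d <= 1 -> (0 < dA (cut_disk d))%E.
Proof.
move=> /andP[d0 d1].
(* The square with sides []-1/2, 0[] and []0, 1/2[] lies in the disk, at distance more than 1 >= d
   from the point 1. *)
have h0 : - 2^-1 < 0 :> R by lra.
have h1 : 0 < 2^-1 :> R by lra.
apply: lt_le_trans (dA_rect_gt0 h0 h1) _.
apply: le_measure; rewrite ?inE; [exact: measurableX|exact: measurable_cut_disk|].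
move=> [x y] /=; rewrite !in_itv/= => -[/andP[x0 x1] /andP[y0 y1]].
by rewrite /cut_disk /Disk /sqdist /=; split; nra.
Qed.

Variables (q d : R).
Hypotheses (q12 : 1 <= q < 2) (d01 : 0 < d <= 1).

Definition cut_potential : R :=
  fine (\int[dA]_(w in cut_disk d) (s1 w `^ (- (q / 2)))%:E)%E.

Local Notation V := cut_potential.

Let msq (k : R) : measurable_fun setT (fun w => s1 w `^ k).
Proof. by apply: measurable_powR_comp; exact: measurable_sqdist. Qed.

Lemma cut_potentialE :
  (\int[dA]_(w in cut_disk d) (s1 w `^ (- (q / 2)))%:E = V%:E)%E.
Proof.
rewrite /cut_potential fineK// ge0_fin_numE; last first.
  by apply: integral_ge0 => w _; rewrite lee_fin powR_ge0.
apply: le_lt_trans (ltry (potential_one q)); rewrite -integral_dA_potential//.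
apply: ge0_subset_integral => //.
- exact: measurable_cut_disk.
- exact: measurable_Disk.
- by apply: measurable_funTS; apply/measurable_EFinP; exact: msq.
- by move=> w _; rewrite lee_fin powR_ge0.
- by move=> w [].
Qed.

Lemma cut_potential_gt0 : 0 < V.
Proof.
have /andP[q1 q2] := q12.
rewrite -lte_fin -cut_potentialE.
(* Squared distances from points of the disk to 1 are at most 4. *)
have c0 : 0 < 4 `^ (- (q / 2)) :> R by exact: powR_gt0.
apply: (@lt_le_trans _ _ (\int[dA]_(w in cut_disk d) (4 `^ (- (q / 2)))%:E)%E).
  rewrite integral_cst; last exact: measurable_cut_disk.
  by rewrite mule_gt0// ?lte_fin// dA_cut_disk_gt0.
apply: ge0_le_integral => //.
- exact: measurable_cut_disk.
- by apply: measurable_funTS; apply/measurable_EFinP; exact: msq.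
- move=> [x y] [wD ws]; have s0 : 0 < s1 (x, y) by exact: le_lt_trans (sqr_ge0 d) ws.
  rewrite lee_fin !powRN lef_pV2 ?posrE ?powR_gt0//; apply: ge0_ler_powR.
  + by rewrite divr_ge0// (le_trans ler01).
  + by rewrite nnegrE ltW.
  + by rewrite nnegrE.
  + by move: wD; rewrite /Disk /sqdist /=; nra.
Qed.

(* [q^-1 - 1 = - p^-1]: the first factor normalises [ext_fun] in [L^p]. *)
Definition ext_density w : R := V `^ (q^-1 - 1) * (\1_(cut_disk d) w * s1 w `^ (- (q / 2))).

Local Notation a := ext_density.

Lemma ext_density_ge0 w : 0 <= a w.
Proof. by rewrite !mulr_ge0 ?powR_ge0. Qed.

Lemma measurable_ext_density : measurable_fun setT a.
Proof.
apply: measurable_funM; first exact: measurable_cst.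
apply: measurable_funM; last exact: msq.
by apply: measurable_indic; exact: measurable_cut_disk.
Qed.

Lemma integral_ext_density : (\int[dA]_(w in D) (a w)%:E = (V `^ q^-1)%:E)%E.
Proof.
have mD := @measurable_Disk R; have V0 := cut_potential_gt0.
rewrite /ext_density; under eq_integral do rewrite EFinM.
rewrite ge0_integralZl//; last 3 first.
- apply: measurable_funTS; apply/measurable_EFinP; apply: measurable_funM.
    by apply: measurable_indic; exact: measurable_cut_disk.
  exact: msq.
- by move=> w _; rewrite lee_fin mulr_ge0 ?powR_ge0.
- by rewrite lee_fin powR_ge0.
have -> : (\int[dA]_(w in D) (\1_(cut_disk d) w * s1 w `^ (- (q / 2)))%:E = V%:E)%E.
  rewrite -cut_potentialE integral_mkcond [RHS]integral_mkcond.
  apply: eq_integral => w _; rewrite /patch indicE.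
  case: ifPn => wD; first by case: ifPn => _; rewrite ?mul1r ?mul0r.
  rewrite memNset// => -[]; by rewrite -[D w]/(D w); move: wD; rewrite notin_setE.
rewrite -EFinM -[X in _ * X]powRr1 ?(ltW V0)// -powRD ?subrK//.
by apply/implyP => _; rewrite gt_eqF.
Qed.

Definition ext_fun w : R[i] := (a w)%:C%C * ('i%C * (toC w - 1)).

Lemma cmeas_ext_fun : cmeas ext_fun.
Proof.
apply: cmeasM; first by split; [exact: measurable_ext_density|exact: measurable_cst].
apply: cmeasM; first exact: cmeas_cst.
by apply: (cmeasD cmeas_toC); exact: cmeas_cst.
Qed.

Lemma toC_sub1 w : toC w - 1 = toC w - toC (1, 0) :> R[i].
Proof. by []. Qed.

Lemma cmod_ext_fun w : cmod (ext_fun w) = a w * Num.sqrt (s1 w).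
Proof.
rewrite /ext_fun !cmodM toC_sub1 cmod_sub.
have -> : cmod ((a w)%:C%C) = a w.
  by rewrite /cmod /= expr0n/= addr0 sqrtr_sqr ger0_norm// ext_density_ge0.
by rewrite /cmod /= expr0n/= add0r expr1n sqrtr1 mul1r.
Qed.

Lemma conjc_sub1 (x : R[i]) : conjc (x - 1) = conjc x - 1.
Proof.
by case: x => u v; apply/eqP; rewrite eq_complex /= oppr0 !addr0 !eqxx.
Qed.

Lemma conjc_rot (r : R) (x : R[i]) :
  conjc (r%:C%C * ('i%C * (x - 1))) = r%:C%C * ('i%C * (1 - conjc x)).
Proof.
case: x => u v; apply/eqP; rewrite eq_complex /=; apply/andP.
by split; apply/eqP; ring.
Qed.

Lemma sqrt_cut_gt w : cut_disk d w -> d < Num.sqrt (s1 w).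
Proof.
move=> [_ ws]; have /andP[d0 _] := d01.
by rewrite -[ltLHS](gtr0_norm d0) -sqrtr_sqr ltr_sqrt// (le_lt_trans (sqr_ge0 d) ws).
Qed.

(** At z = 1 the kernel is exactly 2i times the density. Moving z by at most e adds the quotients X
    and Y below to the 2; each has modulus at most e / (d / 2), since both denominators stay at
    least d / 2. *)
Lemma Im_kern_ext_ge (e : R) z w : 0 <= e <= d / 2 -> Num.sqrt (s1 z) <= e -> D w ->
  (2 - 4 * e / d) * a w <= complex.Im (kern ext_fun z w).
Proof.
move=> /andP[e0 ed] ze wD; have /andP[d0 _] := d01.
have [wc|wc] := pselect (cut_disk d w); last first.
  have a0 : a w = 0 by rewrite /ext_density indicE memNset// mul0r mulr0.
  by rewrite a0 mulr0 /kern /ext_fun a0 rmorph0 !mul0r conjc0 !mulr0 mul0r addr0.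
have sw := sqrt_cut_gt wc.
set W := toC w; set Z := toC z.
have d2 : 0 < d / 2 by rewrite divr_gt0.
have zE : cmod (Z - 1) <= e by rewrite toC_sub1 cmod_sub.
have wE : d < cmod (W - 1) by rewrite toC_sub1 cmod_sub.
have n1 : d / 2 <= cmod (W - Z).
  have := cmodD (W - Z) (Z - 1); rewrite addrA subrK => h.
  by lra.
(* Adding conj W (Z - 1), of modulus at most e, gives 1 - conj W, whose modulus is |W - 1| > d. *)
have n2 : d / 2 <= cmod (1 - conjc W * Z).
  have h := cmodD (1 - conjc W * Z) (conjc W * (Z - 1)).
  have E : 1 - conjc W * Z + conjc W * (Z - 1) = - conjc (W - 1).
    by rewrite conjc_sub1; ring.
  rewrite E cmodN cmodJ cmodM cmodJ in h.
  have W1 : cmod W <= 1.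
    by rewrite cmod_toC -sqrtr1 ler_sqrt//; exact: ltW.
  have : cmod W * cmod (Z - 1) <= e.
    by rewrite -[leRHS]mul1r ler_pM ?cmod_ge0.
  by lra.
have m1 : W - Z != 0.
  apply/eqP => E; move: n1; rewrite E cmodE Normc.normc0; by rewrite leNgt d2.
have m2 : 1 - conjc W * Z != 0.
  apply/eqP => E; move: n2; rewrite E cmodE Normc.normc0; by rewrite leNgt d2.
pose X := (Z - 1) / (W - Z); pose Y := (Z - 1) / (1 - conjc W * Z).
have X1 : cmod X <= e / (d / 2).
  by rewrite /X cmodM cmodV ler_pM ?cmod_ge0 ?invr_ge0 ?cmod_ge0// lef_pV2 ?posrE// (lt_le_trans d2).
have Y1 : cmod Y <= e / (d / 2).
  by rewrite /Y cmodM cmodV ler_pM ?cmod_ge0 ?invr_ge0 ?cmod_ge0// lef_pV2 ?posrE// (lt_le_trans d2).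
have -> : kern ext_fun z w = (a w)%:C%C * ('i%C * (2 + X + Y)).
  rewrite /kern /ext_fun conjc_rot -/W -/Z /X /Y.
  by field; rewrite m1 m2.
have -> : complex.Im ((a w)%:C%C * ('i%C * (2 + X + Y))) = a w * complex.Re (2 + X + Y).
  by case: (2 + X + Y) => u v; rewrite /= !mul0r !mul1r ?sub0r ?add0r ?addr0.
have -> : complex.Re (2 + X + Y) = 2 + complex.Re X + complex.Re Y.
  by case: X {X1} => ? ?; case: Y {Y1}.
rewrite mulrC ler_wpM2l ?ext_density_ge0//.
have := cmod_ge_Re X; rewrite ler_norml => /andP[hX _].
have := cmod_ge_Re Y; rewrite ler_norml => /andP[hY _].
have E : e / (d / 2) + e / (d / 2) = 4 * e / d by field; rewrite gt_eqF.
by lra.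
Qed.

Lemma cmod_Pcauchy_ext_ge (e : R) z : 0 <= e <= d / 2 -> Num.sqrt (s1 z) <= e ->
  (\int[dA]_(w in D) (cmod (kern ext_fun z w))%:E < +oo)%E ->
  (2 - 4 * e / d) * V `^ q^-1 <= cmod (Pcauchy ext_fun z).
Proof.
move=> ed ze foo; have mD := @measurable_Disk R.
have [_ i2] := cint_integrable (cmeas_kern z cmeas_ext_fun) foo.
rewrite PcauchyE cmodN; apply: le_trans (cmod_ge_Im _); apply: le_trans (ler_norm _).
have iat : dA.-integrable D (EFin \o a).
  apply/integrableP; split.
    by apply: measurable_funTS; apply/measurable_EFinP; exact: measurable_ext_density.
  under eq_integral do rewrite /= ger0_norm ?ext_density_ge0//.
  by rewrite integral_ext_density ltry.
have -> : V `^ q^-1 = Rintegral dA D a by rewrite /Rintegral integral_ext_density.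
rewrite -RintegralZl//; apply: le_Rintegral => //.
- have H : dA.-integrable D (fun w => (2 - 4 * e / d)%:E * (EFin \o a) w)%E.
    by apply: integrableZl.
  exact: H.
- by move=> w wD; exact: Im_kern_ext_ge.
Qed.

End Extremal.

(** * The lower bound for the operator norm *)

Section LowerBound.
Context {R : realType}.
Notation D := (@Disk R).
Notation dA := (@dA R).
Notation s1 := (@sqdist R (1, 0)).
Implicit Types (z w : R * R).

Lemma Lnorm_oo_ge (N : set (R * R)) (f : R * R -> \bar R) (L : \bar R) :
  measurable N -> (0 < dA N)%E -> (forall z, N z -> (L <= `|f z|)%E) ->
  (L <= Lnorm dA +oo f)%E.
Proof.
move=> mN N0 LN; rewrite unlock dA_setT_gt0 leNgt; apply/negP => h.
have := ess_sup_ge dA (abse \o f) => H.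
have /negligibleP : dA.-negligible N.
  apply: negligibleS H => z /LN Lz /=; apply/negP; rewrite -ltNge.
  exact: lt_le_trans h Lz.
move=> /(_ mN) N00; have : (dA N = 0)%E by exact: N00.
by move=> E; rewrite E ltxx in N0.
Qed.

Section Unit.
Variables (q d : R).
Hypotheses (q12 : 1 <= q < 2) (d01 : 0 < d <= 1).

Lemma cmod_ext_fun_cut w : cut_disk d w -> cmod (ext_fun q d w) =
  cut_potential q d `^ (q^-1 - 1) * s1 w `^ ((1 - q) / 2).
Proof.
move=> wc; have s0 : 0 < s1 w by case: wc => _; exact: le_lt_trans (sqr_ge0 d).
rewrite cmod_ext_fun /ext_density indicE mem_set// mul1r -mulrA; congr (_ * _).
rewrite -powR12_sqrt ?(ltW s0)// -powRD; last by apply/implyP => _; rewrite gt_eqF.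
by congr (_ `^ _); field.
Qed.

Lemma cmod_ext_fun_out w : ~ cut_disk d w -> cmod (ext_fun q d w) = 0.
Proof. by move=> wc; rewrite cmod_ext_fun /ext_density indicE memNset// mul0r mulr0 mul0r. Qed.

(** Conjugacy, as p + q = p q, turns the exponent p (1 - q) / 2 of the squared distance into - q / 2
    and the exponent p (1/q - 1) of the constant into -1, so the p-th power integrates to V / V. *)
Lemma unit_Lp_ext p : 0 < p -> p^-1 + q^-1 = 1 -> unit_Lp p%:E (ext_fun q d).
Proof.
move=> p0 pq; have [m1 m2] := cmeas_ext_fun q d; split => //; split => //.
have V0 := cut_potential_gt0 q12 d01; set V := cut_potential q d in V0 *.
have /andP[q1 _] := q12; have q0 : 0 < q by exact: lt_le_trans q1.
rewrite /normD unlock.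
have -> : (\int[dA]_x `|(\1_D x * cmod (ext_fun q d x))%:E| `^ p =
   \int[dA]_(w in cut_disk d) ((V `^ (- 1))%:E * (s1 w `^ (- (q / 2)))%:E))%E.
  rewrite [RHS]integral_mkcond; apply: eq_integral => w _; rewrite /patch /=.
  case: ifPn => [|]; last first.
    by rewrite notin_setE => /cmod_ext_fun_out ->; rewrite mulr0 normr0 powR0// gt_eqF.
  rewrite inE => wc; have wD : D w by case: wc.
  rewrite indic_DiskE// ger0_norm ?cmod_ge0// cmod_ext_fun_cut//.
  rewrite powRM ?powR_ge0// -!powRrM -EFinM; congr (_ `^ _ * _ `^ _)%:E.
    have -> : q^-1 = 1 - p^-1 by rewrite -pq addrAC subrr add0r.
    by field; rewrite gt_eqF.
  have pqE : p + q = p * q.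
    by rewrite -[RHS]mulr1 -pq; field; rewrite !gt_eqF.
  have -> : (1 - q) / 2 * p = (p - p * q) / 2 by ring.
  by rewrite -pqE; field.
rewrite ge0_integralZl//; last 4 first.
- exact: measurable_cut_disk.
- apply: measurable_funTS; apply/measurable_EFinP; apply: measurable_powR_comp.
  exact: measurable_sqdist.
- by move=> w _; rewrite lee_fin powR_ge0.
- by rewrite lee_fin powR_ge0.
rewrite cut_potentialE// -/V -EFinM powR_inv1 ?(ltW V0)// mulVf ?gt_eqF//.
by rewrite poweR_EFin powR1.
Qed.

End Unit.

Lemma unit_Lp_ext_oo (d : R) : 0 < d <= 1 -> unit_Lp +oo%E (ext_fun 1 d).
Proof.
move=> d01; have [m1 m2] := cmeas_ext_fun 1 d; split => //; split => //.
have q12 : 1 <= (1 : R) < 2 by rewrite lexx ltr1n.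
have cE w : cut_disk d w -> cmod (ext_fun 1 d w) = 1.
  by move=> wc; rewrite cmod_ext_fun_cut// invr1 subrr mul0r !powRr0 mulr1.
apply/eqP; rewrite eq_le; apply/andP; split.
  rewrite /normD unlock; case: ifPn => // _; apply/ess_supP; apply: aeW => w /=.
  have [wc|wc] := pselect (cut_disk d w).
    by rewrite cE// indic_DiskE ?normr1//; case: wc.
  by rewrite cmod_ext_fun_out// mulr0 normr0 lee_fin.
apply: (@Lnorm_oo_ge (cut_disk d)).
- exact: measurable_cut_disk.
- exact: dA_cut_disk_gt0.
- by move=> w wc; rewrite cE// indic_DiskE/= ?normr1//; case: wc.
Qed.

(** Monotone convergence: the cut disks increase to the whole disk because 1 is not one of its
    points. *)
Lemma cut_potential_cvg (q : R) : 1 <= q < 2 ->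
  cut_potential q n.+1%:R^-1 @[n --> \oo] --> potential_one q.
Proof.
move=> q12; pose F (n : nat) := cut_disk (n.+1%:R^-1 : R).
have H : (\int[dA]_(w in F n) (s1 w `^ (- (q / 2)))%:E @[n --> \oo] -->
    \int[dA]_(w in \bigcup_n F n) (s1 w `^ (- (q / 2)))%:E)%E.
  apply: ge0_nondecreasing_set_cvg_integral.
  - apply/nondecreasing_seqP => n; apply/subsetPset => w [wD]; rewrite /F /cut_disk /=.
    move=> ws; split=> //; apply: le_lt_trans ws.
    by rewrite ler_pXn2r ?nnegrE ?invr_ge0// lef_pV2 ?posrE// ler_nat.
  - by move=> n; exact: measurable_cut_disk.
  - move=> n; apply: measurable_funTS; apply/measurable_EFinP.
    by apply: measurable_powR_comp; exact: measurable_sqdist.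
  - by move=> n w _; rewrite lee_fin powR_ge0.
have cup : \bigcup_n F n = D.
  apply/seteqP; split=> [w [n _ []]//|w wD].
  have s0 : 0 < s1 w.
    move: wD; rewrite /Disk /sqdist /= => wD.
    have := sqr_ge0 (w.2 - 0); have := sqr_ge0 (w.1 - 1); have := sqr_ge0 w.2.
    by move: wD; nra.
  exists (Num.truncn (s1 w)^-1) => //; split => //.
  set m := (Num.truncn _).+1%:R.
  have m0 : 0 < m by rewrite ltr0n.
  have ms : (s1 w)^-1 < m by exact: truncnS_gt.
  have m1 : 1 <= m by rewrite ler1n.
  apply: (@le_lt_trans _ _ m^-1).
    by rewrite expr2 ler_piMr ?invr_ge0 ?(ltW m0)// invf_le1.
  by rewrite -[ltRHS]invrK ltf_pV2 ?posrE ?invr_gt0.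
rewrite cup integral_dA_potential// in H.
exact: fine_cvg H.
Qed.

(** The essential supremum is tested on a rectangle of positive area close to 1 and off the real
    axis. The upper bound enters as a hypothesis to make the kernel integrable at its points. *)
Lemma opnorm_ge (p : \bar R) (q c : R) : 1 <= q < 2 ->
  (forall d, 0 < d <= 1 -> unit_Lp p (ext_fun q d)) ->
  (forall phi z, unit_Lp p phi -> z.1 ^+ 2 + z.2 ^+ 2 < 1 -> z.2 != 0 ->
    (\int[dA]_(w in D) (cmod (phi w) * kern_bound z w)%:E <= c%:E)%E) ->
  forall e d, 0 < e <= 1 -> 0 < d <= 1 ->
  (((2 - e) * cut_potential q d `^ q^-1)%:E <= opnorm p)%E.
Proof.
move=> q12 U H e d /andP[e0 e1] d01; have /andP[d0 d1] := d01.
apply: le_trans (_ : normD +oo%E (Pcauchy (ext_fun q d)) <= _)%E; last first.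
  by apply: ereal_sup_ubound; exists (ext_fun q d) => //; exact: U.
(* The points of the rectangle lie in the disk within 2 t = e d / 4 of 1, so the loss 4 (e d / 4) /
   d in the kernel estimate is exactly [e]. *)
pose t := e * d / 8.
have t0 : 0 < t by rewrite divr_gt0// mulr_gt0.
have t1 : t <= 1 / 8 by rewrite ler_pM2r// mulr_ile1// ltW.
have r1 : 1 - t < 1 - t / 2 by lra.
have r2 : 0 < t / 4 by rewrite divr_gt0.
apply: (@Lnorm_oo_ge (`]1 - t, 1 - t / 2[%classic `*` `]0, t / 4[%classic)).
- exact: measurableX.
- exact: dA_rect_gt0.
move=> z [] /=; rewrite !in_itv/= => /andP[z1 z2] /andP[z3 z4].
have zD : z.1 ^+ 2 + z.2 ^+ 2 < 1 by nra.
have z20 : z.2 != 0 by rewrite gt_eqF.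
have zs : Num.sqrt (s1 z) <= e * d / 4.
  have E : 0 <= e * d / 4 by rewrite divr_ge0// mulr_ge0// ltW.
  rewrite -[leRHS](ger0_norm E) -sqrtr_sqr ler_sqrt ?sqr_ge0//.
  have -> : e * d / 4 = 2 * t by rewrite /t; field.
  by rewrite /sqdist /=; nra.
rewrite indic_DiskE// ger0_norm ?cmod_ge0// lee_fin.
have [foo _] := pointwise_bound (cmeas_ext_fun q d) (H _ _ (U _ d01) zD z20).
have eI : 0 <= e * d / 4 <= d / 2.
  apply/andP; split; first by rewrite divr_ge0// mulr_ge0// ltW.
  have : e * d <= d by rewrite ler_piMl// ltW.
  by lra.
have := cmod_Pcauchy_ext_ge q12 d01 eI zs foo.
by congr (_ * _ <= _); field; rewrite gt_eqF.
Qed.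

End LowerBound.

(** * The value of the norm *)

(** With e and d both equal to 1 / (n + 1), the lower bounds converge to the upper one. Stated for
    an arbitrary [p], so as to serve finite and infinite exponents alike. *)
Lemma opnorm_eq (R : realType) (p : \bar R) (q : R) : 1 <= q < 2 ->
  (forall d, 0 < d <= 1 -> unit_Lp p (ext_fun q d)) ->
  (forall phi z, unit_Lp p phi -> z.1 ^+ 2 + z.2 ^+ 2 < 1 -> z.2 != 0 ->
    (\int[@dA R]_(w in @Disk R) (cmod (phi w) * kern_bound z w)%:E <=
     (2 * potential_one q `^ q^-1)%:E)%E) ->
  opnorm p = (2 * potential_one q `^ q^-1)%:E.
Proof.
move=> q12 U H; have M0 := potential_one_gt0 q12.
have c0 : 0 <= 2 * potential_one q `^ q^-1 by rewrite mulr_ge0 ?powR_ge0.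
have up := opnorm_le c0 H; have lo := opnorm_ge q12 U H.
have n01 (n : nat) : 0 < (n.+1%:R^-1 : R) <= 1.
  by rewrite invr_gt0 ltr0n/= invf_le1// ler1n.
have fin : opnorm p \is a fin_num.
  have I : 0 < (1 : R) <= 1 by rewrite ltr01 lexx.
  by move: up (lo 1 1 I I); case: (opnorm p).
apply/eqP; rewrite eq_le up/= -(fineK fin) lee_fin.
have bcvg : (2 - n.+1%:R^-1) * cut_potential q n.+1%:R^-1 `^ q^-1 @[n --> \oo] -->
    (2 - 0) * potential_one q `^ q^-1.
  apply: cvgM; first by apply: cvgB; [exact: cvg_cst|exact: cvg_harmonic].
  have E : (fun x : R => x `^ q^-1) \o (fun n : nat => cut_potential q n.+1%:R^-1)
      @ \oo --> potential_one q `^ q^-1.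
    apply: cvg_comp; first exact: (cut_potential_cvg q12).
    exact: (continuous_powR M0).
  exact: E.
rewrite subr0 in bcvg.
rewrite -(cvg_lim (@Rhausdorff R) bcvg).
apply: limr_le; first by apply/cvg_ex; exists (2 * potential_one q `^ q^-1).
by near=> n; rewrite -lee_fin fineK// lo.
Unshelve. all: by end_near. Qed.

Theorem theorem1p2 (R : realType) :
  (forall p : R, 2 < p ->
     let q := p / (p - 1) in
     opnorm p%:E =
       (2 * powR (Gamma (2 - q) / Gamma (2 - q / 2) ^+ 2) q^-1)%:E) /\
  opnorm (+oo)%E = (8 / (pi : R))%:E.
Proof.
split=> [p p2 q|].
  have p0 : 0 < p by exact: lt_trans p2.
  have p10 : 0 < p - 1 by lra.
  have pq : p^-1 + q^-1 = 1 by rewrite /q; field; rewrite !gt_eqF.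
  have q12 : 1 <= q < 2.
    by rewrite /q ler_pdivlMr// ltr_pdivrMr//; apply/andP; split; lra.
  apply: opnorm_eq => // [d d01|phi z uphi zD z20]; first exact: unit_Lp_ext.
  exact: (integral_phi_kern p0).
(* For p infinite, q = 1 and the quotient is Gamma(1) / Gamma(3/2)^2 = 4 / pi. *)
have q12 : 1 <= (1 : R) < 2 by rewrite lexx ltr1n.
rewrite (@opnorm_eq R +oo%E 1)//; last 2 first.
- by move=> d; exact: unit_Lp_ext_oo.
- move=> phi z uphi zD z20; rewrite invr1 powRr1 ?(ltW (potential_one_gt0 q12))//.
  exact: integral_phi_kern_oo.
rewrite invr1 powRr1 ?(ltW (potential_one_gt0 q12))// /potential_one; congr EFin.
have -> : 2 - 1 = 1 :> R by ring.
have -> : 2 - 1 / 2 = 2^-1 + 1 :> R by field.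
rewrite Gamma1 GammaS; last by apply/andP; split; lra.
rewrite Gamma_half exprMn sqr_sqrtr ?pi_ge0//.
rewrite div1r invfM exprVn invrK mulrA; congr (_ / _).
by rewrite -natrX -natrM.
Qed.
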